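(* Let $m\ge 1$ and, for $i=1,\ldots,m$, let $\{X^{(i)}_j\}_{j\ge 0}$ be real random variables such that the families for different $i$ are independent of each other, and each family satisfies: $\{X^{(i)}_j\}_{j\ge0}$ are independent, $\mathrm{E}(X^{(i)}_j)=0$, $\mathrm{E}((X^{(i)}_j)^2)=1$ for all $j\ge0$, and $\sup_{j\ge0}\mathrm{E}(|X^{(i)}_j|^k)<\infty$ for every $k\ge3$. For each $n$ and $i$, let $SC^{(i)}_n$ be the $n\times n$ symmetric circulant matrix whose $(r,s)$-th entry is $X^{(i)}_{\frac n2-|\frac n2-|r-s||}/\sqrt n$. Let $\{b_i\}_{1\le i\le m}$ be independent standard Gaussian random variables. Then, as elements of the non-commutative probability space $(\mathcal M_n,\phi_n)$, $\{SC^{(i)}_n\}_{1\le i\le m}$ converges jointly to $\{b_i\}_{1\le i\le m}$; that is, for every complex polynomial $Q$ in $m$ non-commuting variables, $$\phi_n\big(Q(SC^{(1)}_n,\ldots,SC^{(m)}_n)\big)\to \mathrm{E}\big[Q(b_1,\ldots,b_m)\big]\quad\text{as } n\to\infty.$$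
   Context: $\mathcal M_n$ denotes the algebra of $n\times n$ random matrices whose entries have finite moments of all orders, and $\phi_n(A)=\frac1n\mathrm{E}[\mathrm{Tr}(A)]$; $(\mathcal M_n,\phi_n)$ is a non-commutative probability space (a unital complex algebra with a linear functional $\phi_n$ satisfying $\phi_n(I)=1$). The limit variables $b_i$ are viewed in the (commutative) probability space of random variables with all moments finite, with state given by expectation. *)

(* Defs.v *)
From HB Require Import structures.
From mathcomp Require Import all_boot all_order all_algebra.
From mathcomp Require Import all_classical all_reals all_analysis.
From mathcomp Require Import complex.

Set Implicit Arguments.
Unset Strict Implicit.
Unset Printing Implicit Defensive.

Import Order.TTheory GRing.Theory Num.Theory.
Local Open Scope classical_set_scope.
Local Open Scope ring_scope.

Definition indep_family d (T : measurableType d) (R : realType)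
  (P : probability T R) (I : eqType) (F : I -> set (set T)) : Prop :=
  forall (J : seq I), uniq J ->
  forall (A : I -> set T), (forall i, i \in J -> F i (A i)) ->
  P (\bigcap_(i in [set i | i \in J]) A i) = (\prod_(i <- J) P (A i))%E.

Definition sigma_rv d (T : measurableType d) (R : realType) (X : T -> R)
  : set (set T) :=
  preimage_set_system [set: T] X (@measurable _ R).

Definition sigma_rvs d (T : measurableType d) (R : realType)
  (X : nat -> T -> R) : set (set T) :=
  <<s \bigcup_(j in [set: nat]) sigma_rv (X j) >>.

Definition indep_rvs d (T : measurableType d) (R : realType)
  (P : probability T R) (I : eqType) (X : I -> T -> R) : Prop :=
  indep_family P (fun i => sigma_rv (X i)).

Definition cexpectation d (T : measurableType d) (R : realType)
  (P : probability T R) (Y : T -> R[i]) : R[i] :=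
  Complex (fine ('E_P[fun w => complex.Re (Y w)])%E)
          (fine ('E_P[fun w => complex.Im (Y w)])%E).

(* The symmetric circulant random matrix SC_n built from the sequence X:
   (r,s) entry X_{n/2 - |n/2 - |r-s||} / sqrt n, where
   n/2 - |n/2 - |r-s|| = min(|r-s|, n - |r-s|). *)
Definition sym_circulant d (T : measurableType d) (R : realType)
  (X : nat -> T -> R) (n : nat) (w : T) : 'M[R]_n :=
  \matrix_(r < n, s < n)
    (X (minn `|r - s|%N (n - `|r - s|%N)) w / Num.sqrt (n%:R)).

(* Non-commutative complex polynomials in m variables, represented as finite
   formal sums of (coefficient, word) pairs. *)
Definition ncpoly (R : realType) (m : nat) := seq (R[i] * seq 'I_m).

Definition eval_word (R : realType) (m n : nat) (M : 'I_m -> 'M[R[i]]_n)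
  (u : seq 'I_m) : 'M[R[i]]_n :=
  foldr (fun k A => M k *m A) 1%:M u.

Definition eval_ncpoly (R : realType) (m n : nat) (Q : ncpoly R m)
  (M : 'I_m -> 'M[R[i]]_n) : 'M[R[i]]_n :=
  \sum_(t <- Q) t.1 *: eval_word M t.2.

Definition phi_n d (T : measurableType d) (R : realType)
  (P : probability T R) (n : nat) (A : T -> 'M[R[i]]_n) : R[i] :=
  (n%:R)^-1 * cexpectation P (fun w => \tr (A w)).

Definition eval_ncpoly_comm (R : realType) (m : nat) (Q : ncpoly R m)
  (x : 'I_m -> R) : R[i] :=
  \sum_(t <- Q) t.1 * ((\prod_(k <- t.2) x k)%:C)%C.

(* Main.v *)
(* Symmetric circulant matrices of the same size commute: they are all diagonalized by
   the Fourier matrix. So the trace of a word in them is a sum, over the n-th roots of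
   unity z, of products of eigenvalues, and the eigenvalue of SC^(i) at z is a linear
   combination of the independent variables X^(i)_j with coefficients of size at most
   2/sqrt n. The squares of these coefficients add up to 1 + O(1/n), except when
   z^2 = 1, where they add up to at most 2. A moment version of Lindeberg's argument
   then shows that the moments of the eigenvalues are close to the Gaussian ones,
   uniformly in z with z^2 <> 1, while the at most two other roots of unity contribute
   O(1/n) to the normalized trace. Independence of the families turns the expectation
   of a product of eigenvalues into a product of moments, which is the same
   factorization as for the independent Gaussian variables b_i. *)
Require Import Defs.
From HB Require Import structures.
From mathcomp Require Import all_boot all_order all_algebra.
From mathcomp Require Import finmap.
From mathcomp Require Import all_classical all_reals all_analysis.
From mathcomp Require Import measurable_realfun complex.
From mathcomp Require Import cyclic separable cyclotomic ring lra zify.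

Import Order.TTheory GRing.Theory Num.Theory.
Import numFieldTopology.Exports.
Local Open Scope classical_set_scope.
Local Open Scope ring_scope.

Set Implicit Arguments.
Unset Strict Implicit.
Unset Printing Implicit Defensive.

(** * Gaussian approximation of moments of sums *)

(** The moments of the standard Gaussian law: zero for odd [k], the double factorial of [k - 1] for
    even [k]. The recursion is the one that integration by parts yields. *)
Fixpoint gauss_moment (R : realType) (k : nat) : R :=
  match k with
  | 0 => 1
  | 1 => 0
  | k'.+2 => k'.+1%:R * gauss_moment R k'
  end.

Lemma gauss_moment_odd (R : realType) k : odd k -> gauss_moment R k = 0.
Proof.
suff : (odd k -> gauss_moment R k = 0) /\
       (odd k.+1 -> gauss_moment R k.+1 = 0) by case.
elim: k => [|k [IH1 IH2]]; first by split.
by split => // ok; rewrite /= IH1 ?mulr0//; move: ok => /=; rewrite negbK.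
Qed.

(* The [q]-th moment of [\sum_(j <- s) a j * X j] for independent [X j] with moments
   [mu j], expanded by the binomial formula one summand at a time. *)
Fixpoint sum_moment (R : realType) (I : Type) (a : I -> R) (mu : I -> nat -> R)
    (s : seq I) (q : nat) : R :=
  if s is j :: s' then
    \sum_(r < q.+1) 'C(q, r)%:R * (a j ^+ r * mu j r) * sum_moment a mu s' (q - r)
  else (q == 0%N)%:R.

(** First-order Taylor expansion with a remainder uniform on [[0, 2]]. Multiplying the expansion by
    [v + h] creates only one new error term, [p.+1%:R * h ^+ 2 * v ^+ p]. *)
Lemma pow_taylor2 (R : realType) (p : nat) : exists2 c : R, 0 <= c &
  forall v h : R, 0 <= v -> 0 <= h -> v + h <= 2 ->
  `|(v + h) ^+ p.+1 - v ^+ p.+1 - p.+1%:R * h * v ^+ p| <= c * h ^+ 2.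
Proof.
elim: p => [|p [c c0 IH]].
  by exists 0 => // v h *; rewrite !expr1 expr0 mulr1 mul1r addrAC addrK subrr normr0 mul0r.
exists (2 * c + p.+1%:R * 2 ^+ p) => [|v h v0 h0 vh].
  by rewrite addr_ge0// mulr_ge0// exprn_ge0.
have -> : (v + h) ^+ p.+2 - v ^+ p.+2 - p.+2%:R * h * v ^+ p.+1 =
    (v + h) * ((v + h) ^+ p.+1 - v ^+ p.+1 - p.+1%:R * h * v ^+ p)
    + p.+1%:R * h ^+ 2 * v ^+ p.
  by rewrite !exprS -(natr1 p.+1); ring.
rewrite [leRHS]mulrDl (le_trans (ler_normD _ _))// lerD//.
  rewrite normrM -[leRHS]mulrA ler_pM// ?IH//.
  by rewrite ger0_norm ?addr_ge0.
rewrite normrM ger0_norm ?mulr_ge0 ?exprn_ge0// mulrAC ler_wpM2r ?exprn_ge0//.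
rewrite ler_wpM2l// ger0_norm ?exprn_ge0//.
by apply: lerXn2r; rewrite ?nnegrE//; lra.
Qed.

(** A centered Gaussian of variance [v] has [q]-th moment [gauss_moment R q * v ^+ q./2]. When its
    variance grows by [h], the moment of order [q.+2] changes to first order by the quadratic term
    of the binomial expansion, just as for a sum that receives a new centered summand of variance
    [h]. *)
Lemma gauss_moment_step (R : realType) (q : nat) : exists2 c : R, 0 <= c &
  forall v h : R, 0 <= v -> 0 <= h -> v + h <= 2 ->
  `|gauss_moment R q.+2 * (v + h) ^+ q.+2./2 - gauss_moment R q.+2 * v ^+ q.+2./2
    - 'C(q.+2, 2)%:R * h * (gauss_moment R q * v ^+ q./2)| <= c * h ^+ 2.
Proof.
have [oq|eq] := boolP (odd q).
  exists 0 => // v h *.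
  by rewrite /= gauss_moment_odd// mulr0 !mul0r mulr0 !subr0 normr0.
have [c c0 H] := pow_taylor2 R q./2.
exists (q.+1%:R * `|gauss_moment R q| * c) => [|v h v0 h0 vh]; first by rewrite !mulr_ge0.
(* For even [q] this makes the derivative of [v ^+ q./2.+1] and the factor [q.+1] of the Gaussian
   recursion combine into the binomial coefficient. *)
have -> : 'C(q.+2, 2)%:R = q.+1%:R * q./2.+1%:R :> R.
  have -> : 'C(q.+2, 2) = (q.+1 * q./2.+1)%N.
    have e : q.+2 = q./2.+1.*2 by rewrite doubleS even_halfK.
    by rewrite bin2 {1}e -doubleMl doubleK mulnC.
  exact: natrM.
rewrite [gauss_moment R q.+2]/=.
set m := gauss_moment R q; set x := q.+1%:R; set y := q./2.+1%:R.
rewrite (_ : _ - _ = x * m * ((v + h) ^+ q./2.+1 - v ^+ q./2.+1 - y * h * v ^+ q./2)).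
  rewrite normrM [X in X * _]normrM [ `|x| ]ger0_norm ?ler0n//.
  by rewrite -[leRHS]mulrA ler_wpM2l ?H ?mulr_ge0 ?ler0n.
rewrite /=; ring.
Qed.

(** [C] is chosen before the summands, so it is uniform in their number. The error is linear in the
    variance so that it adds up along the list, and the variance is only bounded by 2, a condition
    that passes to tails of the list. *)
Definition sum_moment_approx (R : realType) (K : nat -> R) (q : nat) (C : R) :=
  forall (I : Type) (a : I -> R) (mu : I -> nat -> R)
    (delta : R) (s : seq I),
  delta <= 1 -> (forall j, `|a j| <= delta) ->
  (forall j, mu j 0%N = 1) -> (forall j, mu j 1%N = 0) -> (forall j, mu j 2%N = 1) ->
  (forall j r, `|mu j r| <= K r) ->
  \sum_(j <- s) a j ^+ 2 <= 2 ->
  `|sum_moment a mu s q - gauss_moment R q * (\sum_(j <- s) a j ^+ 2) ^+ q./2|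
    <= C * delta * \sum_(j <- s) a j ^+ 2.

(* Lindeberg's replacement argument: adjoining one summand changes the moments of
   the sum and of the Gaussian variable of the same variance by the same amount,
   up to [O(delta * a j ^+ 2)], and these errors add up to [O(delta * variance)]. *)
Lemma sum_moment_gauss (R : realType) (K : nat -> R) (q : nat) :
  exists2 C : R, 0 <= C & sum_moment_approx K q C.
Proof.
elim/ltn_ind: q => q.
case: q => [|[|q]] IH.
- exists 0 => // I a mu dl s _ _ mu0 _ _ _ _; rewrite !mul0r mul1r expr0.
  suff -> : sum_moment a mu s 0 = 1 by rewrite subrr normr0.
  elim: s => [//|j s IHs]; rewrite /= big_ord1 IHs mu0.
  by rewrite expr0 !mulr1.
- exists 0 => // I a mu dl s _ _ mu0 mu1 _ _ _; rewrite !mul0r subr0.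
  suff -> : sum_moment a mu s 1 = 0 by rewrite normr0.
  elim: s => [//|j s IHs]; rewrite /= big_ord_recl big_ord1 IHs mulr0 add0r.
  by rewrite mu1 mulr0 mulr0 mul0r.
have {IH} /choice [C HC] : forall p, exists c : R, (p < q.+2)%N ->
    0 <= c /\ sum_moment_approx K p c.
  move=> p; have [pq|qp] := ltnP p q.+2; last by exists 0.
  by have [c c0 Hc] := IH p pq; exists c.
(* [B p] bounds the [p]-th moment of any such sum of variance at most 2. Up to the factor
   [dl * a j ^+ 2], [C1] bounds the binomial terms of order at least 3, and [c] below bounds the
   Taylor remainder of the Gaussian moment. *)
pose B p := C p * 2 + `|gauss_moment R p| * 2 ^+ p./2.
pose C1 : R := \sum_(i < q) 'C(q.+2, i.+3)%:R * `|K i.+3| * `|B (q.+2 - i.+3)%N|.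
have C10 : 0 <= C1 by apply: sumr_ge0 => i _; rewrite !mulr_ge0.
have [c c0 Hc] := gauss_moment_step R q.
have [Cq0 HCq] := HC q (leqnSn _).
exists ('C(q.+2, 2)%:R * C q * 2 + C1 + c).
  by rewrite !addr_ge0// !mulr_ge0.
move=> I a mu dl s dl1 adl mu0 mu1 mu2 muK.
have dl0 (j : I) : 0 <= dl by exact: le_trans (normr_ge0 _) (adl j).
have MB s' p : I -> (p < q.+2)%N -> \sum_(j <- s') a j ^+ 2 <= 2 ->
    `|sum_moment a mu s' p| <= `|B p|.
  move=> j pq v2; apply: le_trans (ler_norm _); have [Cp0 HCp] := HC p pq.
  have v0 : 0 <= \sum_(j <- s') a j ^+ 2 by apply: sumr_ge0 => *; exact: sqr_ge0.
  rewrite -[sum_moment _ _ _ _](subrK (gauss_moment R p * (\sum_(j <- s') a j ^+ 2) ^+ p./2)).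
  rewrite (le_trans (ler_normD _ _))// lerD//.
    apply: (le_trans (HCp _ _ _ _ s' dl1 adl mu0 mu1 mu2 muK v2)).
    by rewrite -mulrA ler_wpM2l// -[leRHS]mul1r ler_pM// (dl0 j).
  rewrite normrM ler_wpM2l// ger0_norm ?exprn_ge0//.
  by apply: lerXn2r; rewrite ?nnegrE.
elim: s => [|j s IHs].
  by rewrite !big_nil /= expr0n/= !mulr0 subr0 normr0.
rewrite !big_cons => v2.
set v := \sum_(j <- s) a j ^+ 2 in IHs v2 *.
have a20 := sqr_ge0 (a j).
have v0 : 0 <= v by apply: sumr_ge0 => *; exact: sqr_ge0.
have v2' : v <= 2 by apply: le_trans v2; rewrite lerDr.
(* Order 0 gives the moment of the tail, order 1 vanishes by centering, and order 2 matches the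
   Gaussian increment. The terms in [rest] are small because [|a j| ^+ r <= dl * a j ^+ 2] for
   [r >= 3]. *)
rewrite [sum_moment _ _ _ _]/= !big_ord_recl.
rewrite !bin0 !expr0 mu0 [\val _]/= mu1 subn0 !mulr0 mul0r add0r mulr1 !mul1r.
rewrite [in \val _]/= /bump /= !add1n mu2 mulr1.
set rest := \sum_(i < q) _.
have Hrest : `|rest| <= C1 * dl * a j ^+ 2.
  rewrite /rest (le_trans (ler_norm_sum _ _ _))// -mulrA mulr_suml ler_sum// => i _.
  rewrite (_ : bump 0 _ = i.+3)// 3!normrM normr_nat normrX.
  have M1 := MB s (q.+2 - i.+3)%N j _ v2'.
  have {}M1 : `|sum_moment a mu s (q.+2 - i.+3)| <= `|B (q.+2 - i.+3)%N|.
    by apply: M1; rewrite !subSS (leq_ltn_trans (leq_subr _ _)).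
  have M2 : `|a j| ^+ i.+3 <= dl * a j ^+ 2.
    rewrite -addn2 exprD real_normK ?num_real// ler_wpM2r// exprS.
    rewrite -[leRHS]mulr1 ler_pM ?exprn_ge0// ?adl// exprn_ile1//.
    exact: le_trans (adl j) dl1.
  have M3 : `|mu j i.+3| <= `|K i.+3| by exact: le_trans (muK _ _) (ler_norm _).
  rewrite -[leLHS]mulrA -2![leRHS]mulrA ler_wpM2l// -[leLHS]mulrA [leLHS]mulrC [leRHS]mulrA.
  by apply: ler_pM => //; exact: ler_pM.
have Hg : `|gauss_moment R q.+2 * (a j ^+ 2 + v) ^+ q.+2./2 - gauss_moment R q.+2 * v ^+ q.+2./2
    - 'C(q.+2, 2)%:R * a j ^+ 2 * (gauss_moment R q * v ^+ q./2)| <= c * dl * a j ^+ 2.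
  have := Hc v (a j ^+ 2) v0 a20; rewrite addrC => /(_ v2)/le_trans; apply.
  rewrite -mulrA ler_wpM2l// expr2 ler_wpM2r// -real_normK ?num_real// expr2.
  rewrite -[leRHS]mulr1 ler_pM ?adl//; exact: le_trans (adl j) dl1.
have Hq : `|'C(q.+2, 2)%:R * a j ^+ 2 * (sum_moment a mu s q - gauss_moment R q * v ^+ q./2)|
    <= 'C(q.+2, 2)%:R * C q * 2 * dl * a j ^+ 2.
  have A0 : 0 <= 'C(q.+2, 2)%:R * a j ^+ 2 by apply: mulr_ge0.
  have := HCq _ _ _ _ s dl1 adl mu0 mu1 mu2 muK v2'; rewrite -/v => H.
  rewrite [leRHS](_ : _ = 'C(q.+2, 2)%:R * a j ^+ 2 * (C q * dl * 2)); last by ring.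
  rewrite normrM ger0_norm// ler_wpM2l// (le_trans H)// ler_wpM2l// mulr_ge0//.
  exact: dl0 j.
have -> : (q.+2 - 2 = q)%N by rewrite !subSS subn0.
have := IHs v2'; move: Hg Hq Hrest.
set y := sum_moment _ _ _ _; set x := sum_moment _ _ _ _.
set g2 := _ * (_ + v) ^+ _; set g1 := _ * v ^+ _; set g0 := _ * v ^+ _.
move=> Hg Hq Hrest Hs.
(* The new error is the error of the tail, plus the error of the lower moment of order [q], plus the
   higher-order terms, minus the Gaussian Taylor remainder. *)
have -> : x + ('C(q.+2, 2)%:R * a j ^+ 2 * y + rest) - g2 = (x - g1)
    + 'C(q.+2, 2)%:R * a j ^+ 2 * (y - g0) + rest
    - (g2 - g1 - 'C(q.+2, 2)%:R * a j ^+ 2 * g0) by ring.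
rewrite [leRHS](_ : _ = ('C(q.+2, 2)%:R * C q * 2 + C1 + c) * dl * v
   + 'C(q.+2, 2)%:R * C q * 2 * dl * a j ^+ 2 + C1 * dl * a j ^+ 2
   + c * dl * a j ^+ 2); last by ring.
rewrite (le_trans (ler_normB _ _))// lerD//.
rewrite (le_trans (ler_normD _ _))// lerD//.
by rewrite (le_trans (ler_normD _ _))// lerD.
Qed.

Lemma pow_close1 (R : realType) (v eta : R) (p : nat) : 0 <= v -> v <= 2 ->
  `|v - 1| <= eta -> `|v ^+ p - 1| <= (p%:R * 2 ^+ p) * eta.
Proof.
move=> v0 v2 ve; have e0 : 0 <= eta by exact: le_trans ve.
elim: p => [|p IH]; first by rewrite expr0 subrr normr0 !mul0r.
rewrite (_ : v ^+ p.+1 - 1 = v * (v ^+ p - 1) + (v - 1)); last by rewrite exprS; ring.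
rewrite (le_trans (ler_normD _ _))// normrM (ger0_norm v0).
rewrite (@le_trans _ _ (2 * (p%:R * 2 ^+ p * eta) + 2 ^+ p.+1 * eta))//.
  by rewrite lerD ?ler_pM// (le_trans ve)// ler_peMl// exprn_ege1// ler1n.
by rewrite -natr1 exprS le_eqVlt; apply/orP; left; apply/eqP; ring.
Qed.

(** A single [eta] controls both the size of the coefficients and the deviation of the variance from
    1; [eta <= 1] keeps the variance at most 2. *)
Lemma sum_moment_close (R : realType) (K : nat -> R) (q : nat) :
  exists2 D : R, 0 <= D & forall (I : Type) (a : I -> R) (mu : I -> nat -> R)
    (eta : R) (s : seq I),
  eta <= 1 -> (forall j, `|a j| <= eta) ->
  (forall j, mu j 0%N = 1) -> (forall j, mu j 1%N = 0) -> (forall j, mu j 2%N = 1) ->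
  (forall j r, `|mu j r| <= K r) ->
  `|\sum_(j <- s) a j ^+ 2 - 1| <= eta ->
  `|sum_moment a mu s q - gauss_moment R q| <= D * eta.
Proof.
have [C C0 HC] := sum_moment_gauss K q.
exists (C * 2 + `|gauss_moment R q| * (q./2%:R * 2 ^+ q./2)) =>
    [|I a mu eta s e1 ae mu0 mu1 mu2 muK ve].
  by rewrite addr_ge0 ?mulr_ge0// exprn_ge0.
have e0 : 0 <= eta by exact: le_trans ve.
have v0 : 0 <= \sum_(j <- s) a j ^+ 2 by apply: sumr_ge0 => *; exact: sqr_ge0.
have v2 : \sum_(j <- s) a j ^+ 2 <= 2.
  move: (le_trans ve e1); rewrite ler_norml => /andP[_].
  by rewrite lerBlDr.
have := HC _ a mu eta s e1 ae mu0 mu1 mu2 muK v2.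
set v := \sum_(j <- s) _ in ve v0 v2 *; set x := sum_moment _ _ _ _ => H.
rewrite (_ : x - _ = (x - gauss_moment R q * v ^+ q./2)
  + gauss_moment R q * (v ^+ q./2 - 1)); last by ring.
rewrite (le_trans (ler_normD _ _))// [leRHS]mulrDl lerD//.
  by rewrite (le_trans H)// -!mulrA ler_wpM2l// mulrC ler_wpM2r.
by rewrite normrM -mulrA ler_wpM2l// pow_close1.
Qed.

(** The factors are replaced one at a time; since [eta <= 1], each [x i] stays bounded by
    [|y i| + D i], whence a constant independent of [x]. *)
Lemma prod_close (R : realType) (I : eqType) (r : seq I) (y D : I -> R) :
  (forall i, 0 <= D i) ->
  exists2 C : R, 0 <= C & forall (x : I -> R) (eta : R), 0 <= eta -> eta <= 1 ->
  (forall i, `|x i - y i| <= D i * eta) ->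
  `|\prod_(i <- r) x i - \prod_(i <- r) y i| <= C * eta.
Proof.
move=> D0; elim: r => [|i r [C C0 IH]].
  by exists 0 => // x eta *; rewrite !big_nil subrr normr0 mul0r.
exists ((`|y i| + D i) * C + D i * `|\prod_(i <- r) y i|) => [|x eta e0 e1 xy].
  by rewrite addr_ge0 ?mulr_ge0 ?addr_ge0.
rewrite !big_cons; set X := \prod_(i <- r) x i; set Y := \prod_(i <- r) y i.
rewrite (_ : _ - _ = x i * (X - Y) + (x i - y i) * Y); last by ring.
rewrite (le_trans (ler_normD _ _))// [leRHS]mulrDl lerD//; rewrite normrM.
  rewrite -[leRHS]mulrA ler_pM ?IH// -(subrK (y i) (x i)).
  rewrite (le_trans (ler_normD _ _))// addrC lerD//.
  by rewrite (le_trans (xy i))// ler_piMr.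
by rewrite -[leRHS]mulrA [leRHS]mulrA mulrAC ler_wpM2r.
Qed.

(** * Integration against a density *)

Section density.
Context d1 d2 (T1 : measurableType d1) (T2 : measurableType d2) (R : realType).
Variables (mu : {measure set T1 -> \bar R}) (nu : {measure set T2 -> \bar R}).
Variables (g : T1 -> R) (Y : T1 -> T2).
Hypotheses (mg : measurable_fun setT g) (g0 : forall x, 0 <= g x).
Hypothesis mY : measurable_fun setT Y.
Hypothesis nuE : forall B, measurable B ->
  nu B = (\int[mu]_(x in Y @^-1` B) (g x)%:E)%E.
Import HBNNSimple.

(** By [nuE], [nu] is the image under [Y] of the measure of density [g]. With [Y] the identity this
    covers integration against a density, and with [Y] a random variable it covers laws under a
    weighted measure. For indicators the claim is [nuE] itself. *)
Let integral_density_nnsfun (h : {nnsfun T2 >-> R}) :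
  (\int[nu]_y (h y)%:E = \int[mu]_x (h (Y x) * g x)%:E)%E.
Proof.
pose s : seq R := finmap.enum_fset (fset_set (range h)).
pose A (i : 'I_(size s)) := h @^-1` [set s`_i].
have s0 (i : 'I_(size s)) : 0 <= s`_i.
  have : s`_i \in fset_set (range h) by exact: mem_nth.
  by rewrite in_fset_set// inE => -[y _ <-].
have mA i : measurable (A i) by exact: measurable_funPTI.
have mYA i : measurable (Y @^-1` A i) by rewrite -[X in measurable X]setTI; exact: mY.
have hE y : h y = \sum_(i < size s) s`_i * \1_(A i) y by exact: fimfunEord.
transitivity (\sum_(i < size s) (s`_i)%:E * nu (A i))%E.
  under eq_integral do rewrite hE -sumEFin.
  rewrite ge0_integral_sum//.
  - apply: eq_bigr => i _; under eq_integral do rewrite EFinM.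
    rewrite ge0_integralZl_EFin//; last exact/measurable_EFinP.
    by rewrite integral_indic// setIT.
  - by move=> i; apply/measurable_EFinP; exact: measurable_funM.
  - by move=> i y _; rewrite lee_fin mulr_ge0.
under [RHS]eq_integral do rewrite hE mulr_suml -sumEFin.
rewrite ge0_integral_sum//.
- apply: eq_bigr => i _; under eq_integral do rewrite -mulrA EFinM.
  rewrite ge0_integralZl_EFin//; last 2 first.
    + by move=> x _; rewrite lee_fin mulr_ge0.
    + apply/measurable_EFinP; apply: measurable_funM => //.
      exact: measurableT_comp.
  congr (_ * _)%E; rewrite nuE// integral_mkcond; apply: eq_integral => x _.
  by rewrite epatch_indic muleC EFinM.
- move=> i; apply/measurable_EFinP; apply: measurable_funM => //.
  by apply: measurable_funM => //; exact: measurableT_comp.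
- by move=> i x _; rewrite lee_fin !mulr_ge0.
Qed.

Lemma ge0_integral_density (f : T2 -> R) :
  measurable_fun setT f -> (forall y, 0 <= f y) ->
  (\int[nu]_y (f y)%:E = \int[mu]_x (f (Y x) * g x)%:E)%E.
Proof.
move=> mf f0.
have mf' : measurable_fun setT (EFin \o f) by exact/measurable_EFinP.
pose f_ := nnsfun_approx measurableT mf'.
have f_cvg y : (f_ n y)%:E @[n --> \oo] --> (f y)%:E.
  by apply: cvg_nnsfun_approx => // z _; rewrite lee_fin.
transitivity (limn (fun n => \int[nu]_x (f_ n x)%:E))%E.
  rewrite -monotone_convergence//.
  - by apply: eq_integral => y _; apply/esym/cvg_lim => //; exact: f_cvg.
  - by move=> n; exact/measurable_EFinP/measurable_funP.
  - by move=> n y _; rewrite lee_fin.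
  - by move=> y _ m n mn; rewrite lee_fin; exact/lefP/nd_nnsfun_approx.
rewrite (_ : (fun n => _) = (fun n => \int[mu]_x (f_ n (Y x) * g x)%:E))%E; last first.
  by apply/funext => n; exact: integral_density_nnsfun.
rewrite -monotone_convergence//.
- apply: eq_integral => x _; apply/cvg_lim => //; under eq_fun do rewrite EFinM.
  by rewrite EFinM; apply: cvgeZr => //; exact: f_cvg.
- move=> n; apply/measurable_EFinP; apply: measurable_funM => //.
  by apply: measurableT_comp.
- by move=> n x _; rewrite lee_fin mulr_ge0.
- move=> x _ m n mn; rewrite lee_fin ler_wpM2r//.
  exact/lefP/nd_nnsfun_approx.
Qed.

(** The factor [g >= 0] commutes with taking positive and negative parts. *)
Lemma integral_density (f : T2 -> R) : measurable_fun setT f ->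
  (\int[nu]_y (f y)%:E = \int[mu]_x (f (Y x) * g x)%:E)%E.
Proof.
move=> mf; rewrite [LHS]integralE [RHS]integralE.
have maxM (x y : R) : 0 <= y -> maxe (x * y)%:E 0%E = (Num.max x 0 * y)%:E.
  move=> y0; rewrite -EFin_max; congr EFin.
  by rewrite -[in LHS](mul0r y) maxr_pMl.
congr (_ - _)%E.
- transitivity (\int[nu]_y (Num.max (f y) 0)%:E)%E.
    by apply: eq_integral => y _; rewrite funeposE EFin_max.
  rewrite ge0_integral_density.
  + by apply: eq_integral => x _; rewrite funeposE maxM.
  + exact: measurable_maxr.
  + by move=> y; rewrite le_max lexx orbT.
- transitivity (\int[nu]_y (Num.max (- f y) 0)%:E)%E.
    by apply: eq_integral => y _; rewrite funenegE EFin_max.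
  rewrite ge0_integral_density.
  + by apply: eq_integral => x _; rewrite funenegE -EFinN -mulNr maxM.
  + by apply: measurable_maxr => //; exact: measurableT_comp.
  + by move=> y; rewrite le_max lexx orbT.
Qed.

Lemma integrable_density (f : T2 -> R) : measurable_fun setT f ->
  mu.-integrable setT (fun x => (f (Y x) * g x)%:E) ->
  nu.-integrable setT (EFin \o f).
Proof.
move=> mf /integrableP[_ ifg]; apply/integrableP; split; first exact/measurable_EFinP.
rewrite [ltLHS](_ : _ = \int[nu]_y (`|f y|)%:E)%E; last by apply: eq_integral.
rewrite integral_density; last exact: measurableT_comp.
move: ifg; congr (_ < _)%E; apply: eq_integral => x _.
by rewrite abse_EFin normrM (ger0_norm (g0 x)).
Qed.

End density.

(** * Moments of the Gaussian distribution *)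

Section gaussian_moments.
Context {R : realType}.
Local Notation mu := (@lebesgue_measure R).

(** This is the [k]-th power of [y / k <= expR (y / k)]. *)
Lemma pow_le_expR (k : nat) (y : R) : 0 <= y -> y ^+ k <= k%:R ^+ k * expR y.
Proof.
move=> y0; case: k => [|k]; first by rewrite !expr0 mul1r -[leLHS]expR0 ler_expR.
have k0 : 0 < k.+1%:R :> R by [].
have -> : y = k.+1%:R * (y / k.+1%:R) by rewrite mulrC divfK// gt_eqF.
rewrite exprMn expRM_natl ler_wpM2l ?exprn_ge0// lerXn2r ?nnegrE ?divr_ge0 ?expR_ge0//.
by rewrite (le_trans _ (expR_ge1Dx _))// lerDr.
Qed.

(** Unnormalized Gaussian densities of variance 1 and 2; the wider one, [psi], dominates every power
    times [phi]. *)
Let phi (x : R) := expR (- x ^+ 2 / 2).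
Let psi (x : R) := expR (- x ^+ 2 / 4).

Let pow_gauss_bound (k : nat) : exists2 C : R, 0 <= C &
  forall x, `|x ^+ k * phi x| <= C * psi x.
Proof.
exists (1 + (4 * k%:R) ^+ k) => [|x].
  by rewrite addr_ge0// exprn_ge0// mulr_ge0.
have y0 : 0 <= x ^+ 2 / 4 by rewrite divr_ge0// sqr_ge0.
rewrite normrM (@ger0_norm _ (phi x)) ?expR_ge0// /phi.
rewrite (_ : - x ^+ 2 / 2 = - (x ^+ 2 / 4) + - x ^+ 2 / 4); last by field.
rewrite expRD mulrA ler_wpM2r ?expR_ge0// expRN ler_pdivrMr ?expR_gt0// mulrDl mul1r.
have xk : `|x ^+ k| <= 1 + (x ^+ 2) ^+ k.
  rewrite normrX -real_normK ?num_real// -exprM mulnC exprM.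
  have : 0 <= (`|x| ^+ k - 1) ^+ 2 by exact: sqr_ge0.
  have : 0 <= `|x| ^+ k by rewrite exprn_ge0.
  set u := `|x| ^+ k; nra.
rewrite (le_trans xk)// lerD//; first by rewrite -[leLHS]expR0 ler_expR.
have -> : (x ^+ 2) ^+ k = 4 ^+ k * (x ^+ 2 / 4) ^+ k by rewrite -exprMn mulrC divfK.
by rewrite [in leRHS]exprMn -[leRHS]mulrA ler_wpM2l ?exprn_ge0 ?pow_le_expR.
Qed.

(** The bound for the exponent [k.+1] leaves a factor [1 / n.+1] to spare. *)
Let cvgn_phi k : n.+1%:R ^+ k * phi n.+1%:R @[n --> \oo] --> (0 : R).
Proof.
have [C C0 HC] := pow_gauss_bound k.+1.
apply: (@squeeze_cvgr _ _ _ _ (fun=> 0) (fun n => C * harmonic n)).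
- near=> n; rewrite mulr_ge0 ?exprn_ge0 ?expR_ge0//= /harmonic/=.
  rewrite ler_pdivlMr// mulrC mulrA -exprS.
  apply: le_trans (ler_norm _) _; apply: le_trans (HC _) _.
  rewrite ler_piMr// -[leRHS]expR0 ler_expR mulNr oppr_le0.
  by rewrite divr_ge0// sqr_ge0.
- exact: cvg_cst.
- by rewrite -[X in _ --> X](mulr0 C); apply: cvgMr; exact: cvg_harmonic.
Unshelve. all: end_near. Qed.

Let integrable_psi : mu.-integrable setT (EFin \o psi).
Proof.
have s0 : Num.sqrt 2 != 0 :> R by rewrite gt_eqF// sqrtr_gt0.
have := integrable_normal_pdf (0 : R) (Num.sqrt 2).
have peak0 := gt_eqF (normal_peak_gt0 s0).
move/(integrableZl measurableT (normal_peak (Num.sqrt 2))^-1).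
apply: eq_integrable => // x _ /=; rewrite normal_pdfE// -EFinM mulrA mulVf ?peak0// mul1r.
congr (expR _)%:E; rewrite /psi subr0 sqr_sqrtr//; congr (_ / _).
by rewrite -mulr_natr -natrM.
Qed.

Let measurable_pow_phi k : measurable_fun setT (fun x : R => x ^+ k * phi x).
Proof.
apply: measurable_funM; first exact: measurable_funX.
apply: measurableT_comp => //; apply: measurable_funM => //.
by apply: measurableT_comp => //; exact: measurable_funX.
Qed.

Let integrable_pow_phi k : mu.-integrable setT (fun x => (x ^+ k * phi x)%:E).
Proof.
have [C C0 HC] := pow_gauss_bound k.
apply: (@le_integrable _ _ _ mu setT measurableT _ (fun x => (C * psi x)%:E)).
- apply/measurable_EFinP; exact: measurable_pow_phi.
- move=> x _; rewrite !abse_EFin lee_fin; apply: le_trans (HC x) _; exact: ler_norm.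
- exact: (integrableZl measurableT C integrable_psi).
Qed.

(* Integration by parts: [x^(k+1) phi - k x^(k-1) phi] is the derivative of [- x^k phi]. *)
Let integral_pow_phi_rec k :
  (\int[mu]_x (x ^+ k.+1 * phi x - k%:R * (x ^+ k.-1 * phi x))%:E = 0)%E.
Proof.
(* At [k = 0] the truncated exponent [k.-1] is harmless, its coefficient being 0. *)
pose f (x : R) := x ^+ k.+1 * phi x - k%:R * (x ^+ k.-1 * phi x).
pose F (x : R) := - (x ^+ k * phi x).
have mf : measurable_fun setT f.
  by apply: measurable_funB => //; exact: measurable_funM.
have intf : mu.-integrable setT (EFin \o f).
  have i1 := integrableZl measurableT k%:R (integrable_pow_phi k.-1).
  by have := integrableB measurableT (integrable_pow_phi k.+1) i1; apply: eq_integrable.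
have dX (n : nat) (x : R) : is_derive x (1 : R) (fun y : R => y ^+ n) (n%:R * x ^+ n.-1).
  rewrite (_ : (fun y => _) = id ^+ n); last by apply/funext => y; rewrite exprfctE.
  by apply: (is_derive_eq (is_deriveX n (is_derive_id x 1))); rewrite scaler1.
have dphi (x : R) : is_derive x (1 : R) phi (- (x * phi x)).
  have dh : is_derive x (1 : R) (fun y : R => - y ^+ 2 / 2) (- x).
    rewrite (_ : (fun y => _) = (- 2^-1) *: (fun y : R => y ^+ 2)); last first.
      apply/funext => y; have e : - y ^+ 2 / 2 = - 2^-1 * y ^+ 2 by field.
      exact: e.
    apply: (is_derive_eq (is_deriveZ _ (dX 2 x))).
    by rewrite /GRing.scale/= expr1; field.
  apply: (is_derive_eq (is_derive1_comp (is_derive_expR _) dh)).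
  by rewrite mulrN mulrC.
have dF (x : R) : is_derive x (1 : R) F (f x).
  rewrite (_ : F = - ((fun y : R => y ^+ k) * phi)); last by apply/funext.
  apply: (is_derive_eq (is_deriveN (is_deriveM (dX k x) (dphi x)))).
  by rewrite /f /GRing.scale/= exprS; ring.
have cphi : continuous phi.
  by move=> x; apply/differentiable_continuous/derivable1_diffP.
have cf : continuous f.
  move=> x; apply: cvgB.
    by apply: cvgM; [exact: exprn_continuous|exact: cphi].
  apply: cvgMr; by apply: cvgM; [exact: exprn_continuous|exact: cphi].
(* The integrals over [[- a n, a n]] are computed in two ways: as boundary values of [F], which tend
   to 0, and by dominated convergence, which gives the integral over the whole line. *)
pose a (n : nat) : R := n.+1%:R.
have ftc (n : nat) : (\int[mu]_(x in `[(- a n)%R, a n]) (f x)%:E =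
    (F (a n) - F (- a n))%:E)%E.
  have n0 : 0 < a n by rewrite /a.
  rewrite (continuous_FTC2 (F := F))//.
  - by rewrite (lt_trans _ n0)// oppr_lt0.
  - exact: continuous_subspaceT.
  - have cF : continuous F by move=> x; apply/differentiable_continuous/derivable1_diffP.
    split.
    + by move=> x _.
    + by apply: cvg_at_right_filter; exact: cF.
    + by apply: cvg_at_left_filter; exact: cF.
  - by move=> x _; rewrite derive1E derive_val.
have lim1 : (\int[mu]_(x in `[(- a n)%R, a n]) (f x)%:E)%E @[n --> \oo] --> (0%R%:E : \bar R)%E.
  rewrite (_ : (fun n => _) = (fun n => (F (a n) - F (- a n))%:E)); last exact/funext.
  apply: cvg_EFin; first by apply: nearW.
  rewrite (_ : _ \o _ = fun n => - (1 - (-1) ^+ k) * (n.+1%:R ^+ k * phi n.+1%:R)); last first.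
    apply/funext => n /=; rewrite /F -/(a n).
    have -> : phi (- a n) = phi (a n) by rewrite /phi sqrrN.
    rewrite [(- a n) ^+ k]exprNn; ring.
  by rewrite -[X in _ --> X](mulr0 (- (1 - (-1) ^+ k))); apply: cvgMr; exact: cvgn_phi.
have lim2 : (\int[mu]_(x in `[(- a n)%R, a n]) (f x)%:E)%E @[n --> \oo] -->
    (\int[mu]_x (f x)%:E)%E.
  have mEf := measurable_int mu intf.
  have [//|||||_ _] := @dominated_convergence _ _ _ mu setT measurableT
    (fun n => (EFin \o f) \_ `[(- a n)%R, a n]) (EFin \o f) (abse \o (EFin \o f)).
  - move=> n; have mI : measurable (`[- a n, a n]%classic : set R) := measurable_itv _.
    by apply: (iffLR (measurable_restrictT _ mI)); exact: measurable_funTS.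
  - exact: mEf.
  - apply: aeW => x _; apply: cvg_near_cst; near=> n; rewrite patchE mem_set//=.
    rewrite in_itv/= -ler_norml /a -natr1 ler_wpDr//; near: n; exact: nbhs_infty_ger.
  - exact: integrable_abse.
  - by apply: aeW => x n _; rewrite patchE; case: ifP => // _; rewrite abse0 abse_ge0.
  by apply: cvg_trans; apply: near_eq_cvg; near=> n; rewrite integral_mkcond.
exact: (cvg_unique _ lim2 lim1).
Unshelve. all: end_near. Qed.

(** Stated for any measure agreeing with the standard normal law on measurable sets, so as to apply
    to the distribution of a random variable. *)
Lemma normal_moments (nu : {measure set R -> \bar R}) k :
  (forall B, measurable B -> nu B = normal_prob (0 : R) 1 B) ->
  nu.-integrable setT (fun x => (x ^+ k)%:E) /\
  \int[nu]_x (x ^+ k) = gauss_moment R k.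
Proof.
move=> nuE'.
have pdfE : normal_pdf (0 : R) 1 = fun x => normal_peak 1 * phi x.
  apply/funext => x; rewrite normal_pdfE ?oner_neq0// /normal_fun /phi subr0 expr1n.
  by [].
have mpdf := measurable_normal_pdf (0 : R) 1.
have pdf0 := normal_pdf_ge0 (0 : R) 1.
have mX j : measurable_fun setT (fun x : R => x ^+ j) by exact: measurable_funX.
have nuE (B : set R) : measurable B -> nu B =
    (\int[mu]_(x in id @^-1` B) (normal_pdf 0 1 x)%:E)%E by exact: nuE'.
have int k' : mu.-integrable setT (fun x => (x ^+ k' * normal_pdf 0 1 x)%:E).
  rewrite pdfE.
  have := integrableZl measurableT (normal_peak 1) (integrable_pow_phi k').
  by apply: eq_integrable => // x _ /=; rewrite -EFinM mulrCA.
split.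
  by have /(_ _ (mX k) (int k)) := @integrable_density _ _ _ _ R mu nu (normal_pdf 0 1) id
    mpdf pdf0 (@measurable_id _ _ setT) nuE.
rewrite /Rintegral (@integral_density _ _ _ _ R mu nu (normal_pdf 0 1) id
  mpdf pdf0 (@measurable_id _ _ setT) nuE _ (mX k)).
pose M j := \int[mu]_x (x ^+ j * normal_pdf 0 1 x).
have rec j : M j.+1 = j%:R * M j.-1.
  rewrite /M -RintegralZl//; last exact: int.
  apply/eqP; rewrite -subr_eq0 -RintegralB//; last 2 first.
  - exact: int.
  - exact: (integrableZl measurableT j%:R (int j.-1)).
  rewrite pdfE.
  under eq_Rintegral do rewrite mulrCA [X in _ - _ * X]mulrCA [X in _ - X]mulrCA -mulrBr.
  rewrite RintegralZl//; last first.
    have i1 := integrableZl measurableT j%:R (integrable_pow_phi j.-1).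
    by have := integrableB measurableT (integrable_pow_phi j.+1) i1; apply: eq_integrable.
  by rewrite /Rintegral integral_pow_phi_rec mulr0.
rewrite -[LHS]/(M k).
suff : M k = gauss_moment R k /\ M k.+1 = gauss_moment R k.+1 by case.
elim: k => [|k [IH1 IH2]].
  split; last by rewrite rec mul0r.
  rewrite /M; under eq_Rintegral do rewrite expr0 mul1r.
  by rewrite /Rintegral integral_normal_pdf.
by split => //; rewrite rec IH1.
Qed.

End gaussian_moments.

(** * Independent random variables *)

Section independence.
Context d (T : measurableType d) (R : realType) (P : probability T R).
Variables (I : eqType) (Y : I -> {RV P >-> R}).
Hypothesis indY : indep_rvs P (fun i => Y i : T -> R).

Let mY i : measurable_fun setT (Y i) := measurable_funP (Y i).

(* Indicators are replaced by the functions [f i] one at a time: for fixed other factors,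
   both sides are integrals of [f j], against proportional measures. *)
Lemma indep_prod_ge0 (J K : seq I) (f : I -> R -> R) (A : I -> set R) :
  (forall i, measurable_fun setT (f i)) -> (forall i x, 0 <= f i x) ->
  (forall i, i \in J -> P.-integrable setT (fun w => (f i (Y i w))%:E)) ->
  (forall i, measurable (A i)) -> uniq (J ++ K) ->
  (\int[P]_w (\prod_(i <- J) f i (Y i w) * \prod_(i <- K) \1_(A i) (Y i w))%:E =
   (\prod_(i <- J) \int[P]_w (f i (Y i w)) *
    \prod_(i <- K) fine (P (Y i @^-1` A i)))%:E)%E.
Proof.
move=> mf f0.
have mpre i (B : set R) : measurable B -> measurable (Y i @^-1` B).
  by move=> mB; rewrite -[X in measurable X]setTI; exact: mY.
elim: J K A => [|j J IH] K A intf mA uJK.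
  rewrite big_nil mul1r.
  transitivity (P (\bigcap_(i in [set i | i \in K]) (Y i @^-1` A i))).
    rewrite -[X in P X]setIT -integral_indic//; last first.
      by apply: fin_bigcap_measurable => // i _; exact: mpre.
    apply: eq_integral => w _; rewrite big_nil mul1r; congr EFin.
    rewrite indicE; have [/set_mem wA|] := boolP (w \in _).
      by rewrite big1_seq// => i /andP[_ iK]; rewrite indicE mem_set//; exact: wA.
    apply: contraNeq; rewrite prodf_seq_neq0 => /allP H; apply/mem_set => i /= iK.
    have := H i iK; rewrite /= indicE.
    by have [/set_mem//|] := boolP (_ \in A i); rewrite eqxx.
  rewrite indY//; last first.
    by move=> i _; exists (A i); rewrite ?setTI.
  rewrite -prodEFin; apply: eq_bigr => i _; rewrite fineK//.
  by apply: fin_num_measure; exact: mpre.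
have [jJK uJK'] : j \notin J ++ K /\ uniq (J ++ K) by move: uJK => /= /andP.
pose g w := \prod_(i <- J) f i (Y i w) * \prod_(i <- K) \1_(A i) (Y i w).
have g0 w : 0 <= g w.
  by rewrite mulr_ge0//; apply: prodr_ge0.
have mg : measurable_fun setT g.
  apply: measurable_funM; apply: measurable_prod => i _; apply: measurableT_comp => //.
have intJ i : i \in J -> P.-integrable setT (fun w => (f i (Y i w))%:E).
  by move=> iJ; apply: intf; rewrite inE iJ orbT.
(* The induction hypothesis, with [j] moved to the indicators and carrying an arbitrary set [B],
   says that the image under [Y j] of the measure of density [g] is [c] times the law of [Y j]. *)
pose c : R := \prod_(i <- J) \int[P]_w (f i (Y i w)) * \prod_(i <- K) fine (P (Y i @^-1` A i)).
have c0 : 0 <= c.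
  by rewrite mulr_ge0// prodr_ge0// => i _; [exact: Rintegral_ge0|exact: fine_ge0].
pose nu : {measure set R -> \bar R} := mscale (NngNum c0) (distribution P (Y j)).
have nuE (B : set R) : measurable B -> nu B = (\int[P]_(x in Y j @^-1` B) (g x)%:E)%E.
  move=> mB; rewrite /nu /mscale /= /distribution /pushforward.
  pose A' i := if i == j then B else A i.
  have A'K : {in K, A' =1 A}.
    by move=> i iK; rewrite /A'; case: eqP jJK => // <-; rewrite mem_cat iK orbT.
  have mA' i : measurable (A' i) by rewrite /A'; case: ifP.
  have u' : uniq (J ++ j :: K) by rewrite -cat1s uniq_catCA.
  have := IH (j :: K) A' intJ mA' u'; rewrite big_cons.
  have -> : \prod_(i <- K) fine (P (Y i @^-1` A' i)) = \prod_(i <- K) fine (P (Y i @^-1` A i)).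
    by apply: eq_big_seq => i iK; rewrite A'K.
  rewrite {2}/A' eqxx mulrCA -/c mulrC EFinM fineK ?fin_num_measure//; last exact: mpre.
  move=> H; rewrite [LHS](_ : _ = (c%:E * P (Y j @^-1` B))%E)// -H.
  rewrite [RHS]integral_mkcond; apply: eq_integral => w _.
  rewrite epatch_indic big_cons /A' eqxx -EFinM /g mulrCA mulrC; congr (_ * _)%:E.
  congr (_ * _); apply: eq_big_seq => i iK.
  by have := A'K i iK; rewrite /A' => ->.
transitivity (\int[P]_w (f j (Y j w) * g w)%:E)%E.
  by apply: eq_integral => w _; rewrite big_cons mulrA.
rewrite -(@ge0_integral_density _ _ _ _ _ P nu g (Y j))//.
rewrite ge0_integral_mscale//=; last 2 first.
- exact/measurable_EFinP.
- by move=> x _; rewrite lee_fin.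
rewrite ge0_integral_distribution//=; last 2 first.
- exact/measurable_EFinP.
- by move=> x; rewrite lee_fin.
rewrite [RHS](_ : _ = (c * \int[P]_w (f j (Y j w)))%:E); last first.
  by rewrite big_cons -mulrA mulrC.
rewrite [RHS]EFinM /Rintegral fineK//; apply: integrable_fin_num => //; apply: intf.
by rewrite inE eqxx.
Qed.

(* The indices move from [J] to [K] as their functions are replaced by their positive and
   negative parts. *)
Lemma indep_prod_cat (J K : seq I) (f : I -> R -> R) :
  (forall i, measurable_fun setT (f i)) ->
  (forall i, i \in K -> forall x, 0 <= f i x) ->
  (forall i, i \in J ++ K -> P.-integrable setT (fun w => (f i (Y i w))%:E)) ->
  uniq (J ++ K) ->
  P.-integrable setT (fun w => (\prod_(i <- J ++ K) f i (Y i w))%:E) /\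
  \int[P]_w (\prod_(i <- J ++ K) f i (Y i w)) =
  \prod_(i <- J ++ K) \int[P]_w (f i (Y i w)).
Proof.
elim: J K f => [|j J IH] K f mf f0 intf uJK.
  (* The absolute value changes nothing on [K] and makes the functions nonnegative at every index,
     as [indep_prod_ge0] asks. *)
  pose f' i x := `|f i x|.
  have f'K w : \prod_(i <- K) f' i (Y i w) = \prod_(i <- K) f i (Y i w).
    by apply: eq_big_seq => i iK; rewrite /f' ger0_norm// f0.
  have intf' i : i \in K -> P.-integrable setT (fun w => (f' i (Y i w))%:E).
    by move=> iK; apply: eq_integrable (intf i iK) => // w _; rewrite /f' ger0_norm// f0.
  have mf' i : measurable_fun setT (f' i) by exact: measurableT_comp.
  have uK : uniq (K ++ [::]) by rewrite cats0.
  have f'0 i x : 0 <= f' i x by exact: normr_ge0.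
  have := indep_prod_ge0 (K := [::]) (A := fun=> setT) mf' f'0 intf' (fun=> measurableT) uK.
  under eq_integral do rewrite big_nil mulr1 f'K; rewrite big_nil mulr1.
  rewrite (_ : \prod_(i <- K) _ = \prod_(i <- K) \int[P]_w (f i (Y i w))) => [H|]; last first.
    by apply: eq_big_seq => i iK; apply: eq_Rintegral => w _; rewrite /f' ger0_norm// f0.
  split; last by rewrite /= /Rintegral H.
  apply/integrableP; split.
    apply/measurable_EFinP; apply: measurable_prod => i _.
    by apply: measurableT_comp => //; exact: mf.
  rewrite [ltLHS](_ : _ = (\int[P]_w (\prod_(i <- K) f i (Y i w))%:E)%E); first by rewrite H ltry.
  by apply: eq_integral => w _; rewrite /= -f'K ger0_norm// prodr_ge0.
have jJK : j \notin J ++ K by move: uJK => /= /andP[].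
(* For [s = 1] and [s = -1] the function at [j] becomes the positive and the negative part of
   [f j]. *)
pose fs (s : R) i x := if i == j then Num.max (s * f j x) 0 else f i x.
have pJK : perm_eq (J ++ j :: K) ((j :: J) ++ K).
  by rewrite -cat1s perm_catCA.
have mfs s i : measurable_fun setT (fs s i).
  rewrite /fs; case: eqP => // _; apply: measurable_maxr => //.
  exact: measurable_funM.
have fs0 s i : i \in j :: K -> forall x, 0 <= fs s i x.
  rewrite inE /fs; case: eqP => //= [_ _ x|_]; last exact: f0.
  by rewrite le_max lexx orbT.
have ints s i : i \in J ++ j :: K -> P.-integrable setT (fun w => (fs s i (Y i w))%:E).
  rewrite (perm_mem pJK) => ijK; have := intf _ ijK; rewrite /fs; case: eqP => // -> ij.
  apply: (le_integrable measurableT (g := fun w => (s * f j (Y j w))%:E)).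
  - apply/measurable_EFinP; apply: measurable_maxr => //; apply: measurable_funM => //.
    exact: measurableT_comp.
  - move=> w _; rewrite !abse_EFin lee_fin.
    by rewrite /Num.max; case: ifP => // _; rewrite normr0.
  - exact: (integrableZl measurableT s ij).
have us : uniq (J ++ j :: K) by rewrite (perm_uniq pJK).
have Hs s := IH (j :: K) (fs s) (mfs s) (fs0 s) (ints s) us.
have fsE (w : T) s : \prod_(i <- J ++ j :: K) fs s i (Y i w) =
    Num.max (s * f j (Y j w)) 0 * \prod_(i <- J ++ K) f i (Y i w).
  rewrite (perm_big _ pJK)/= big_cons {1}/fs eqxx; congr (_ * _).
  apply: eq_big_seq => i iJK; rewrite /fs; case: eqP => // ij.
  by move: jJK; rewrite -ij iJK.
have fsEI s : \prod_(i <- J ++ j :: K) \int[P]_w (fs s i (Y i w)) =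
    \int[P]_w (Num.max (s * f j (Y j w)) 0) * \prod_(i <- J ++ K) \int[P]_w (f i (Y i w)).
  rewrite (perm_big _ pJK)/= big_cons {1}/fs eqxx; congr (_ * _).
  apply: eq_big_seq => i iJK; rewrite /fs; case: eqP => // ij.
  by move: jJK; rewrite -ij iJK.
have maxE (x : R) : x = Num.max (1 * x) 0 - Num.max (-1 * x) 0.
  rewrite mul1r mulN1r /Num.max oppr_lt0.
  by have [x0|x0|->] := ltgtP x 0; rewrite ?sub0r ?opprK ?subr0 ?oppr0.
have fE w : \prod_(i <- (j :: J) ++ K) f i (Y i w) =
   \prod_(i <- J ++ j :: K) fs 1 i (Y i w) - \prod_(i <- J ++ j :: K) fs (-1) i (Y i w).
  by rewrite !fsE -mulrBl -maxE /= big_cons.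
have [i1 e1] := Hs 1; have [i2 e2] := Hs (-1).
split.
  under eq_fun do rewrite fE EFinB.
  exact: integrableB.
under eq_Rintegral do rewrite fE.
rewrite RintegralB// e1 e2 !fsEI -mulrBl /= big_cons; congr (_ * _).
under [RHS]eq_Rintegral do rewrite (maxE (f j _)).
have jj : j \in J ++ j :: K by rewrite mem_cat mem_head orbT.
rewrite RintegralB//.
  by have := ints 1 j jj; rewrite /fs eqxx.
by have := ints (-1) j jj; rewrite /fs eqxx.
Qed.
End independence.

(** A finite set of pairs is split by first coordinate: the event of each row lies in the
    sigma-algebra of its family, so [hfam] separates the rows and [hind] the variables within a
    row. *)
Lemma indep_family_rvs d (T : measurableType d) (R : realType)
    (P : probability T R) (m : nat) (X : 'I_m -> nat -> {RV P >-> R}) :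
  indep_family P (fun i => sigma_rvs (fun j => X i j : T -> R)) ->
  (forall i, indep_rvs P (fun j => X i j : T -> R)) ->
  indep_rvs P (fun p : 'I_m * nat => X p.1 p.2 : T -> R).
Proof.
move=> hfam hind J uJ A hA.
pose Js i := [seq p.2 | p <- J & p.1 == i].
pose B i := \bigcap_(j in [set j | j \in Js i]) A (i, j).
have memJs i j : (j \in Js i) = ((i, j) \in J).
  apply/mapP/idP => [[[i' j']]|ij]; last by exists (i, j) => //; rewrite mem_filter eqxx.
  by rewrite mem_filter /= => /andP[/eqP -> ?] ->.
have uJs i : uniq (Js i).
  rewrite map_inj_in_uniq ?filter_uniq// => -[a1 a2] [b1 b2].
  by rewrite !mem_filter /= => /andP[/eqP -> _] /andP[/eqP -> _] ->.
have -> : \bigcap_(p in [set p | p \in J]) A p =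
    \bigcap_(i in [set i | i \in enum 'I_m]) B i.
  apply/seteqP; split => [w Aw i _ j /=|w Bw [i j] /= ij].
    by rewrite memJs; exact: Aw.
  by apply: (Bw i) => /=; [rewrite mem_enum|rewrite memJs].
rewrite hfam ?enum_uniq//; last first.
  move=> i _; pose U := \bigcup_(j in [set: nat]) sigma_rv (X i j : T -> R).
  apply: (@fin_bigcap_measurable _ (g_sigma_algebraType U) _ _ (fun j => A (i, j))) => // j /= jJ.
  apply: sub_sigma_algebra; exists j => //.
  by have := hA (i, j); apply; rewrite -memJs.
rewrite (eq_bigr (fun i => \prod_(j <- Js i) P (A (i, j))))%E; last first.
  move=> i _; rewrite /B (hind i)// => j; rewrite memJs => /hA.
  by [].
rewrite big_enum /=.
rewrite (partition_big (fun p => p.1) xpredT)//=; apply: eq_bigr => i _.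
rewrite /Js big_map big_filter /=; apply: eq_bigr => -[i' j] /eqP /= ->.
by [].
Qed.

Lemma Rintegral_prob_cst d (T : measurableType d) (R : realType)
  (P : probability T R) (c : R) : \int[P]_w c = c.
Proof. by have := expectation_cst P c; rewrite unlock /Rintegral /cst => ->. Qed.

Lemma Rintegral_lincomb d (T : measurableType d) (R : realType)
    (mu : {measure set T -> \bar R}) (I : Type) (r : seq I) (c : I -> R) (V : I -> T -> R) :
  (forall i, mu.-integrable setT (EFin \o V i)) ->
  mu.-integrable setT (EFin \o (fun w => \sum_(i <- r) c i * V i w)) /\
  \int[mu]_w (\sum_(i <- r) c i * V i w) = \sum_(i <- r) c i * \int[mu]_w V i w.
Proof.
move=> iV; elim: r => [|i r [IH1 IH2]].
  rewrite big_nil; split.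
    by apply: eq_integrable (integrable0 _ _) => // w _ /=; rewrite big_nil.
  under eq_Rintegral do rewrite big_nil.
  by rewrite Rintegral_cst// mul0r.
have iV' := integrableZl measurableT (c i) (iV i).
split.
  have := integrableD measurableT iV' IH1; apply: eq_integrable => // w _ /=.
  by rewrite big_cons -EFinM -EFinD.
under eq_Rintegral do rewrite big_cons.
by rewrite RintegralD// RintegralZl// IH2 big_cons.
Qed.

(** * Moments of linear combinations of independent variables *)

Section moments.
Context d (T : measurableType d) (R : realType) (P : probability T R).
Variables (I : eqType) (Y : I -> {RV P >-> R}).
Hypothesis indY : indep_rvs P (fun i => Y i : T -> R).
Hypothesis intY : forall i k, P.-integrable setT (fun w => (Y i w ^+ k)%:E).

Definition moment i k : R := \int[P]_w (Y i w ^+ k).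

Lemma moment0 i : moment i 0 = 1.
Proof.
rewrite /moment; under eq_Rintegral do rewrite expr0.
exact: Rintegral_prob_cst.
Qed.

(* [g] behaves, in expectations, as if it were independent of [Y i], [i \in s]. *)
Definition decoupled (g : T -> R) (s : seq I) := forall e : I -> nat,
  P.-integrable setT (fun w => (g w * \prod_(i <- s) Y i w ^+ e i)%:E) /\
  \int[P]_w (g w * \prod_(i <- s) Y i w ^+ e i) =
  \int[P]_w g w * \prod_(i <- s) moment i (e i).

Lemma decoupled_cst1 s : uniq s -> decoupled (fun=> 1) s.
Proof.
move=> us e.
have us0 : uniq (s ++ [::]) by rewrite cats0.
have [|//||i1 e1] := indep_prod_cat indY (f := fun i x => x ^+ e i) _ _ _ us0.
- by move=> i; exact: measurable_funX.
- by move=> i _; exact: intY.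
rewrite cats0 in i1 e1.
split; first by apply: eq_integrable i1 => // w _; rewrite mul1r.
under eq_Rintegral do rewrite mul1r.
by rewrite e1 Rintegral_prob_cst mul1r.
Qed.

Lemma decoupled_int g s : decoupled g s -> P.-integrable setT (EFin \o g).
Proof.
move=> /(_ (fun=> 0%N))[+ _]; apply: eq_integrable => // w _ /=.
by rewrite big1 ?mulr1// => i _; rewrite expr0.
Qed.

(** The exponents in [decoupled] are free, so the one at [j] can be set to [r] and its power
    absorbed into [g]. *)
Lemma decoupled_cons g j s r : uniq (j :: s) -> decoupled g (j :: s) ->
  decoupled (fun w => g w * Y j w ^+ r) s /\
  \int[P]_w (g w * Y j w ^+ r) = \int[P]_w g w * moment j r.
Proof.
move=> /= /andP[js us] dg.
pose e' (e : I -> nat) i := if i == j then r else e i.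
have prodE (e : I -> nat) (S : I -> nat -> R) :
    \prod_(i <- j :: s) S i (e' e i) = S j r * \prod_(i <- s) S i (e i).
  rewrite big_cons {1}/e' eqxx; congr (_ * _); apply: eq_big_seq => i si.
  by rewrite /e'; case: eqP js => // <-; rewrite si.
have main e : P.-integrable setT (fun w => (g w * Y j w ^+ r * \prod_(i <- s) Y i w ^+ e i)%:E) /\
    \int[P]_w (g w * Y j w ^+ r * \prod_(i <- s) Y i w ^+ e i) =
    \int[P]_w g w * moment j r * \prod_(i <- s) moment i (e i).
  have [i1 e1] := dg (e' e); split.
    by apply: eq_integrable i1 => // w _; rewrite (prodE e (fun i k => Y i w ^+ k)) mulrA.
  move: e1; rewrite prodE mulrA => <-.
  by apply: eq_Rintegral => w _; rewrite (prodE e (fun i k => Y i w ^+ k)) mulrA.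
have eq1 : \int[P]_w (g w * Y j w ^+ r) = \int[P]_w g w * moment j r.
  have [_] := main (fun=> 0%N).
  rewrite [X in _ * X]big1 ?mulr1 => [<-|i _]; last exact: moment0.
  apply: eq_Rintegral => w _; rewrite [X in _ = _ * X]big1 ?mulr1// => i _.
by split => // e; have [i1 e1] := main e; split => //; rewrite e1 eq1.
Qed.

Lemma decoupled0 s : decoupled (fun=> 0) s.
Proof.
move=> e; split; first by apply: eq_integrable (integrable0 _ _) => // w _; rewrite mul0r.
by under eq_Rintegral do rewrite mul0r; rewrite !Rintegral_prob_cst mul0r.
Qed.

Lemma decoupled_lin g h c s : decoupled g s -> decoupled h s ->
  decoupled (fun w => c * g w + h w) s.
Proof.
move=> dg dh e.
have [i1 e1] := dg e; have [i2 e2] := dh e.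
have i1' := integrableZl measurableT c i1.
have i3 := decoupled_int dg; have i4 := decoupled_int dh.
have i3' := integrableZl measurableT c i3.
split.
  have := integrableD measurableT i1' i2; apply: eq_integrable => // w _ /=.
  by rewrite -EFinM -EFinD mulrDl mulrA.
under eq_Rintegral do rewrite mulrDl -mulrA.
rewrite !RintegralD// !RintegralZl// e1 e2; ring.
Qed.

Lemma decoupled_sum (K : Type) (r : seq K) (c : K -> R) (g : K -> T -> R) s :
  (forall k, decoupled (g k) s) ->
  decoupled (fun w => \sum_(k <- r) c k * g k w) s /\
  \int[P]_w (\sum_(k <- r) c k * g k w) = \sum_(k <- r) c k * \int[P]_w g k w.
Proof.
move=> dg; split; last first.
  by apply: (Rintegral_lincomb _ _ _).2 => k; exact: decoupled_int (dg k).
elim: r => [|k r dr].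
  rewrite (_ : (fun w => _) = fun=> 0); first exact: decoupled0.
  by apply/funext => w; rewrite big_nil.
have -> : (fun w => \sum_(k <- k :: r) c k * g k w) =
    (fun w => c k * g k w + \sum_(k <- r) c k * g k w).
  by apply/funext => w; rewrite big_cons.
exact: decoupled_lin.
Qed.

(** Expanding by the head summand and absorbing its power into [g] reproduces the recursion of
    [sum_moment]. The list [s'] reserves variables for later factors. *)
Lemma decoupled_pow (a : I -> R) s s' g q : uniq (s ++ s') -> decoupled g (s ++ s') ->
  decoupled (fun w => g w * (\sum_(i <- s) a i * Y i w) ^+ q) s' /\
  \int[P]_w (g w * (\sum_(i <- s) a i * Y i w) ^+ q) =
  \int[P]_w g w * sum_moment a moment s q.
Proof.
elim: s g q => [|j s IH] g q.
  rewrite /= => _ dg.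
  have -> : (fun w => g w * (\sum_(i <- [::]) a i * Y i w) ^+ q) =
      (fun w => (q == 0%N)%:R * g w + 0).
    by apply/funext => w; rewrite big_nil expr0n addr0 mulrC.
  split; first by apply: decoupled_lin => //; exact: decoupled0.
  have ig := decoupled_int dg.
  under eq_Rintegral do rewrite addr0.
  by rewrite RintegralZl// mulrC.
move=> us dg; have us' : uniq (s ++ s') by move: us => /= /andP[].
have expE w : g w * (\sum_(i <- j :: s) a i * Y i w) ^+ q =
    \sum_(r < q.+1) ('C(q, r)%:R * a j ^+ r) *
      (g w * Y j w ^+ r * (\sum_(i <- s) a i * Y i w) ^+ (q - r)).
  rewrite big_cons addrC exprDn mulr_sumr; apply: eq_bigr => r _.
  rewrite -mulr_natr exprMn; ring.
have H (r : 'I_q.+1) := IH _ (q - r)%N us' (decoupled_cons r us dg).1.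
have -> : (fun w => g w * (\sum_(i <- j :: s) a i * Y i w) ^+ q) =
    (fun w => \sum_(r < q.+1) ('C(q, r)%:R * a j ^+ r) *
      (g w * Y j w ^+ r * (\sum_(i <- s) a i * Y i w) ^+ (q - r))).
  exact/funext.
have [d1 e1] := decoupled_sum (index_enum 'I_q.+1) (fun r : 'I_q.+1 => 'C(q, r)%:R * a j ^+ r)
  (fun r => (H r).1).
split; first exact: d1.
rewrite e1 /= mulr_sumr; apply: eq_bigr => r _.
rewrite (H r).2 (decoupled_cons r us dg).2; ring.
Qed.

(** The blocks [S l] are disjoint, so they can be absorbed into [g] one after another. *)
Lemma decoupled_prod_pow (L : Type) (ls : seq L) (S : L -> seq I) (a : I -> R)
    (q : L -> nat) s' g :
  uniq (flatten [seq S l | l <- ls] ++ s') ->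
  decoupled g (flatten [seq S l | l <- ls] ++ s') ->
  decoupled (fun w => g w * \prod_(l <- ls) (\sum_(i <- S l) a i * Y i w) ^+ q l) s' /\
  \int[P]_w (g w * \prod_(l <- ls) (\sum_(i <- S l) a i * Y i w) ^+ q l) =
  \int[P]_w g w * \prod_(l <- ls) sum_moment a moment (S l) (q l).
Proof.
elim: ls g => [|l ls IH] g.
  move=> _ dg; rewrite big_nil mulr1.
  have E : (fun w => g w * \prod_(l <- [::]) (\sum_(i <- S l) a i * Y i w) ^+ q l) = g.
    by apply/funext => w; rewrite big_nil mulr1.
  by rewrite E.
rewrite /= -catA => us dg.
have [d1 e1] := decoupled_pow a (q l) us dg.
have us' : uniq (flatten [seq S l | l <- ls] ++ s').
  by move: us; rewrite cat_uniq => /and3P[].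
have [d2 e2] := IH _ us' d1.
have E : (fun w => g w * \prod_(l <- l :: ls) (\sum_(i <- S l) a i * Y i w) ^+ q l) =
  (fun w => g w * (\sum_(i <- S l) a i * Y i w) ^+ q l *
     \prod_(l <- ls) (\sum_(i <- S l) a i * Y i w) ^+ q l).
  by apply/funext => w; rewrite big_cons mulrA.
rewrite E; split => //; by rewrite e2 e1 big_cons mulrA.
Qed.

End moments.

(** * Spectrum of symmetric circulant matrices *)

Section circulant_spectrum.
Context {R : realType} (n : nat).
Local Notation N := n.+1.
Implicit Types (z : R[i]) (k l : 'I_N).

(** Distance to 0 on the cycle of residues modulo [N]; at [|r - s|] it is the index of the variable
    in the entry [(r, s)]. *)
Definition cdist (l : nat) : nat := minn l (N - l).

Lemma val_ordN l : val (- l) = (if val l == 0%N then 0 else N - l)%N.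
Proof.
rewrite /=; case: eqP => [->|/eqP l0]; first by rewrite subn0 modnn.
by rewrite modn_small// ltn_subLR ?(ltnW (ltn_ord l))// -[ltnLHS]add0n ltn_add2r lt0n.
Qed.

Lemma val_ordD k l : val (k + l) = (if k + l < N then k + l else k + l - N)%N.
Proof.
rewrite /=; case: ltnP => kl; first by rewrite modn_small.
rewrite -[in LHS](subnK kl) modnDr modn_small// ltn_subLR//.
by rewrite -addnS leq_add// ltnW.
Qed.

Lemma cdistN l : cdist (- l) = cdist l.
Proof.
rewrite /cdist [nat_of_ord (- l)]val_ordN; case: eqP => [l0|_].
  by rewrite [nat_of_ord l]l0.
by rewrite subKn 1?minnC// ltnW.
Qed.

Lemma cdist_distD k l : cdist `|k - (k + l)%R|%N = cdist l.
Proof.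
rewrite /cdist [nat_of_ord (k + l)]val_ordD; have := ltn_ord k; have := ltn_ord l.
case: (ltnP (k + l) N) => kl ? ?; first by rewrite IntDist.distnEr; lia.
by rewrite IntDist.distnEl; lia.
Qed.

Lemma cdist_eq k l : (cdist k == cdist l) = (k == l) || (k == - l).
Proof.
rewrite /cdist -!val_eqE [val (- l)]val_ordN /=.
have := ltn_ord k; have := ltn_ord l; case: (@eqP _ (nat_of_ord l) 0%N); lia.
Qed.

Lemma root_ordD z k l : z ^+ N = 1 -> z ^+ (k + l)%R = z ^+ k * z ^+ l.
Proof. by move=> zN; rewrite -exprD -[RHS](expr_mod _ zN). Qed.

Lemma root_ordN z l : z ^+ N = 1 -> z ^+ (- l)%R * z ^+ l = 1.
Proof. by move=> zN; rewrite -root_ordD// addNr. Qed.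

Lemma root_norm z : z ^+ N = 1 -> `|z| = 1.
Proof.
by move=> zN; apply/eqP; rewrite -(@pexpr_eq1 _ _ N)// -normrX zN normr1.
Qed.

Lemma root_conj z l : z ^+ N = 1 -> ((z ^+ l)^*)%C = z ^+ (- l)%R.
Proof.
move=> zN; have nz : `|z ^+ l| = 1 by rewrite normrX root_norm// expr1n.
have z0 : z ^+ l != 0 by rewrite -normr_eq0 nz oner_eq0.
apply: (mulIf z0); rewrite root_ordN// mulrC -sqr_normc nz expr1n.
by [].
Qed.

(* The coefficient of the variable [x j] in the eigenvalue at the root of unity [z]: all
   the entries at cyclic distance [j] from the diagonal are [x j]. *)
Definition eigen_coef z (j : nat) : R :=
  complex.Re (\sum_(l < N | cdist l == j) z ^+ l).

(** The sum is real: negating [l] preserves [cdist] and conjugates [z ^+ l]. *)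
Lemma eigen_coefE z j : z ^+ N = 1 ->
  ((eigen_coef z j)%:C)%C = \sum_(l < N | cdist l == j) z ^+ l.
Proof.
move=> zN; rewrite /eigen_coef ReJ_add rmorph_sum/=.
rewrite [X in _ + X](_ : _ = \sum_(l < N | cdist l == j) z ^+ l).
  by rewrite -mulr2n -[X in X / _]mulr_natr mulfK// pnatr_eq0.
rewrite [RHS](reindex_inj oppr_inj)/=; apply: eq_big => [l|l _].
  by rewrite cdistN.
by rewrite root_conj.
Qed.

Lemma eigen_coef_dist z l : z ^+ N = 1 ->
  ((eigen_coef z (cdist l))%:C)%C =
  z ^+ l + (if l == - l then 0 else z ^+ (- l)%R).
Proof.
move=> zN; rewrite eigen_coefE// (bigD1 l)//=; congr (_ + _).
under eq_bigl do rewrite cdist_eq.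
case: eqP => [ll|/eqP ll].
  by rewrite big_pred0// => k; rewrite -ll orbb andbN.
rewrite (big_pred1 (- l))// => k /=.
by have [->|kl] := eqVneq k l; rewrite ?andbT//= (negbTE ll).
Qed.

Lemma eigen_coef_le2 z j : z ^+ N = 1 -> `|eigen_coef z j| <= 2.
Proof.
move=> zN; have n1 (k : 'I_N) : `|z ^+ k| = 1 by rewrite normrX root_norm// expr1n.
have [[l lj]|noj] := pselect (exists l : 'I_N, cdist l = j); last first.
  rewrite /eigen_coef big_pred0 ?normr0// => l; apply/eqP => lj.
  by apply: noj; exists l.
have : `|((eigen_coef z j)%:C)%C| <= 2.
  rewrite -lj eigen_coef_dist// (le_trans (ler_normD _ _))// n1.
  by case: ifP => _; rewrite ?normr0 ?n1 ?addr0// ler1n.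
have -> : `|((eigen_coef z j)%:C)%C| = (`|eigen_coef z j|%:C)%C.
  by rewrite normc_def/= expr0n/= addr0 sqrtr_sqr.
by rewrite -(rmorph_nat (real_complex R) 2) lecR.
Qed.

Lemma sum_root z : z ^+ N = 1 -> \sum_(l < N) z ^+ l = if z == 1 then N%:R else 0.
Proof.
move=> zN; case: eqP => [->|/eqP z1].
  by under eq_bigr do rewrite expr1n; rewrite sumr_const card_ord.
have : (z - 1) * \sum_(l < N) z ^+ l = 0 by rewrite -subrX1 zN subrr.
by move/eqP; rewrite mulf_eq0 subr_eq0 (negbTE z1) => /eqP.
Qed.

(** The only candidates are 0 and, for even [N], its half. *)
Lemma card_selfinv : (#|[pred l : 'I_N | l == - l]| <= 2)%N.
Proof.
rewrite (leq_trans _ (_ : #|pred2 ord0 (inord N./2 : 'I_N)| <= 2)%N)//; last first.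
  by rewrite card2; case: (_ != _).
apply/subset_leq_card/fintype.subsetP => l; rewrite !inE -!val_eqE [val (- l)]val_ordN.
have lN := ltn_ord l; have [/eqP ->//|l0] := eqVneq (val l) 0%N.
move=> /eqP e; rewrite [X in _ == X]inordK; last lia.
by apply/eqP; move: e lN => /=; lia.
Qed.

(** Expanding one factor of each square turns the sum into one over residues [l] of [z ^+ l] times
    the coefficient at [cdist l], that is [(z ^+ 2) ^+ l + 1], without the 1 when [l = - l]. The
    first part is a geometric sum. *)
Lemma sum_eigen_coef2 z : z ^+ N = 1 ->
  \sum_(j < N) eigen_coef z j ^+ 2 =
  (if z ^+ 2 == 1 then N%:R else 0) + N%:R - #|[pred l : 'I_N | l == - l]|%:R.
Proof.
move=> zN; apply: (fmorph_inj (real_complex R)).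
rewrite rmorph_sum rmorphB rmorphD /= !rmorph_nat.
transitivity (\sum_(l < N) z ^+ l * ((eigen_coef z (cdist l))%:C)%C).
  transitivity (\sum_(j < N) \sum_(l < N | cdist l == j) z ^+ l * ((eigen_coef z j)%:C)%C).
    apply: eq_bigr => j _; rewrite -mulr_suml -eigen_coefE// rmorphXn /=.
    by rewrite expr2.
  rewrite (exchange_big_dep xpredT)//=; apply: eq_bigr => l _.
  have lN : (cdist l < N)%N by rewrite (leq_ltn_trans (geq_minl _ _)).
  by rewrite (big_pred1 (Ordinal lN))// => j; rewrite eq_sym.
transitivity (\sum_(l < N) ((z ^+ 2) ^+ l + 1 - (l == - l)%:R)).
  apply: eq_bigr => l _; rewrite eigen_coef_dist// mulrDr -exprM mulnC exprM.
  rewrite -[in RHS]exprM muln2 -addnn exprD -addrA; congr (_ + _).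
  case: eqP => [ll|_]; first by rewrite mulr0 subrr.
  by rewrite mulrC root_ordN// subr0.
rewrite big_split big_split /= sumr_const card_ord sum_root; last first.
  by rewrite -exprM mulnC exprM zN expr1n.
congr (_ + _ + _); first by case: ifP => _; rewrite ?rmorph_nat ?rmorph0.
rewrite sumrN -natr_sum -sum1_card; congr (- _%:R).
by rewrite [RHS]big_mkcond; apply: eq_bigr => l _; rewrite inE; case: (l == - l).
Qed.

Definition circ_eigen (x : nat -> R) z : R := \sum_(j < N) eigen_coef z j * x j.

(** Ungrouping the residues by distance gives the usual circulant eigenvalue, the discrete Fourier
    transform of the first row. *)
Lemma circ_eigenE x z : z ^+ N = 1 ->
  ((circ_eigen x z)%:C)%C = \sum_(l < N) ((x (cdist l))%:C)%C * z ^+ l.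
Proof.
move=> zN; rewrite rmorph_sum /=.
transitivity (\sum_(j < N) \sum_(l < N | cdist l == j) ((x j)%:C)%C * z ^+ l).
  by apply: eq_bigr => j _; rewrite -mulr_sumr -eigen_coefE// rmorphM /= mulrC.
rewrite (exchange_big_dep xpredT)//=; apply: eq_bigr => l _.
have lN : (cdist l < N)%N by rewrite (leq_ltn_trans (geq_minl _ _)).
by rewrite (big_pred1 (Ordinal lN))// => j; rewrite eq_sym.
Qed.

Definition circ_mx (x : nat -> R) : 'M[R[i]]_N :=
  \matrix_(r, s) ((x (cdist `|r - s|%N))%:C)%C.

(** * Simultaneous diagonalization by the Fourier matrix *)

Section diagonalization.
Variable w : R[i].
Hypothesis w_prim : N.-primitive_root w.

Let wN (t : nat) : (w ^+ t) ^+ N = 1.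
Proof. by rewrite exprAC (prim_expr_order w_prim) expr1n. Qed.

Let F : 'M[R[i]]_N := \matrix_(r, t) (w ^+ t) ^+ r.
Let G : 'M[R[i]]_N := \matrix_(t, r) (N%:R^-1 * (w ^+ t)^-1 ^+ r).

Let GF : G *m F = 1%:M.
Proof.
have w0 t : w ^+ t != 0 by rewrite expf_neq0// (prim_root_eq0 w_prim).
apply/matrixP => t t'; rewrite !mxE.
transitivity (N%:R^-1 * \sum_(r < N) ((w ^+ t)^-1 * w ^+ t') ^+ r).
  by rewrite mulr_sumr; apply: eq_bigr => r _; rewrite !mxE exprMn mulrA.
rewrite sum_root; last by rewrite exprMn exprVn !wN invr1 mulr1.
have -> : (w ^- t * w ^+ t' == 1) = (t == t').
  rewrite -(inj_eq (mulfI (w0 t))) mulVKf// mulr1 (eq_prim_root_expr w_prim).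
  by rewrite !modn_small// eq_sym.
by case: eqP => _; rewrite ?mulr0// mulVf// pnatr_eq0.
Qed.

(** Shifting the summation index by [r] modulo [N] makes the matrix entry depend on the shift [l]
    alone and factors out [(w ^+ t) ^+ r]. *)
Let circ_mxF x : circ_mx x *m F = F *m diag_mx (\row_t ((circ_eigen x (w ^+ t))%:C)%C).
Proof.
apply/matrixP => r t; rewrite mul_mx_diag !mxE circ_eigenE// mulr_sumr.
rewrite (reindex_inj (addrI r)); apply: eq_bigr => l _.
by rewrite !mxE cdist_distD root_ordD// mulrCA.
Qed.

Lemma trace_circ_word (m : nat) (x : 'I_m -> nat -> R) (u : seq 'I_m) :
  \tr (eval_word (fun i => circ_mx (x i)) u) =
  \sum_(t < N) ((\prod_(i <- u) circ_eigen (x i) (w ^+ t))%:C)%C.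
Proof.
pose D u := diag_mx (\row_(t < N) ((\prod_(i <- u) circ_eigen (x i) (w ^+ t))%:C)%C).
have WF : eval_word (fun i => circ_mx (x i)) u *m F = F *m D u.
  elim: u => [|i u IH] /=.
    rewrite mul1mx /D (_ : diag_mx _ = 1%:M) ?mulmx1//.
    by rewrite -diag_const_mx; congr diag_mx; apply/rowP => t; rewrite !mxE big_nil.
  rewrite -mulmxA IH mulmxA circ_mxF -mulmxA; congr (_ *m _).
  rewrite mulmx_diag; congr diag_mx; apply/rowP => t; rewrite !mxE big_cons.
  by rewrite rmorphM.
have FG : F *m G = 1%:M by exact: mulmx1C GF.
rewrite -[X in \tr X]mulmx1 -FG mulmxA WF mxtrace_mulC mulmxA GF mul1mx mxtrace_diag.
by apply: eq_bigr => t _; rewrite mxE.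
Qed.

(** Both sides say that [N] divides [2 * t]; with [card_selfinv], at most two roots are
    exceptional. *)
Lemma root_sqr_eq1 (t : 'I_N) : ((w ^+ t) ^+ 2 == 1) = (t == - t).
Proof.
rewrite -exprM -(prim_order_dvd w_prim) -val_eqE [val (- t)]val_ordN.
have tN := ltn_ord t; have [t0|/eqP t0] := eqVneq (val t) 0%N.
  rewrite [nat_of_ord t]t0 mul0n dvdn0; apply/esym/eqP; exact: t0.
move: t0; rewrite -[\val t]/(nat_of_ord t) => /eqP t0.
apply/idP/eqP => [/dvdnP[[|[|q]]]|tt]; [lia|lia|nia|].
by apply/dvdnP; exists 1%N; lia.
Qed.

End diagonalization.

(** In characteristic 0, ['X^N - 1] is separable, and a list of [N] distinct [N]-th roots of unity
    contains a primitive one. *)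
Lemma prim_root_exists : exists w : R[i], N.-primitive_root w.
Proof.
have [r Dp] := closed_field_poly_normal ('X^N - 1 : {poly R[i]}).
rewrite (monicP _) ?monicXnsubC// scale1r in Dp.
suff /hasP[w _ wP] : has N.-primitive_root r by exists w.
apply: has_prim_root => //.
- by apply/allP => z; rewrite -root_prod_XsubC -Dp.
- by rewrite -separable_prod_XsubC -Dp separable_Xn_sub_1// pnatr_eq0.
- by rewrite -ltnS -(size_prod_XsubC r id) -Dp size_XnsubC.
Qed.

End circulant_spectrum.

(** * Convergence of the words *)

Lemma prod_count (R : comPzSemiRingType) (m : nat) (F : 'I_m -> R) (u : seq 'I_m) :
  \prod_(k <- u) F k = \prod_(i < m) F i ^+ count_mem i u.
Proof.
rewrite (partition_big id xpredT)//=; apply: eq_bigr => i _.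
rewrite (eq_bigr (fun=> F i)) => [|k /eqP -> //].
by rewrite big_const_seq iter_mulr_1.
Qed.

Section complex_expectation.
Context d (T : measurableType d) (R : realType) (P : probability T R).

Lemma cexpectation_lin (I : Type) (r : seq I) (c : I -> R[i]) (V : I -> T -> R) :
  (forall i, P.-integrable setT (EFin \o V i)) ->
  cexpectation P (fun w => \sum_(i <- r) c i * ((V i w)%:C)%C) =
  \sum_(i <- r) c i * ((\int[P]_w V i w)%:C)%C.
Proof.
move=> iV.
(* The real and imaginary parts are treated at once, as real-linear maps [h]. *)
have lin (h : R[i] -> R) : (forall x y, h (x + y) = h x + h y) ->
    (forall x v, h (x * (v%:C)%C) = h x * v) -> h 0 = 0 ->
  fine ('E_P[fun w => h (\sum_(i <- r) c i * ((V i w)%:C)%C)%R])%E =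
  h (\sum_(i <- r) c i * ((\int[P]_w V i w)%:C)%C).
  move=> hD hM h0; rewrite unlock.
  rewrite -[LHS]/(\int[P]_w h (\sum_(i <- r) c i * ((V i w)%:C)%C)).
  have hS (v : I -> R) : h (\sum_(i <- r) c i * ((v i)%:C)%C) = \sum_(i <- r) h (c i) * v i.
    by elim: r => [|i r' IH]; rewrite ?big_nil// !big_cons hD hM IH.
  under eq_Rintegral do rewrite hS; rewrite hS.
  by rewrite (Rintegral_lincomb _ _ _).2.
rewrite /cexpectation lin; last first.
- by [].
- by case=> x y v /=; rewrite mulr0 subr0.
- by case=> x1 y1 [x2 y2].
rewrite lin; last first.
- by [].
- by case=> x y v /=; rewrite mulr0 add0r.
- by case=> x1 y1 [x2 y2].
by case: (\sum_(i <- r) _).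
Qed.

End complex_expectation.

(** * Moments of words in the Gaussian variables *)

Section gaussian_limit.
Context d (T : measurableType d) (R : realType) (P : probability T R) (m : nat).
Variable b : 'I_m -> {RV P >-> R}.
Hypothesis indb : indep_rvs P (fun i => b i : T -> R).
Hypothesis gaussb : forall i (A : set R), measurable A ->
  distribution P (b i) A = normal_prob 0 1 A.

Lemma gaussian_pow i k :
  P.-integrable setT (fun w => (b i w ^+ k)%:E) /\
  \int[P]_w (b i w ^+ k) = gauss_moment R k.
Proof.
have [/integrableP[_ i1] e1] := normal_moments k (gaussb i).
have mX : measurable_fun setT (fun x : R => x ^+ k) by exact: measurable_funX.
have ib : P.-integrable setT (fun w => (b i w ^+ k)%:E).
  apply/integrableP; split.
    by apply/measurable_EFinP; apply: measurable_funX.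
  move: i1; rewrite ge0_integral_distribution//.
  by apply: measurableT_comp => //; exact/measurable_EFinP.
split => //; rewrite -e1 /Rintegral integral_distribution//.
exact/measurable_EFinP.
Qed.

Lemma gaussian_word (u : seq 'I_m) :
  P.-integrable setT (fun w => (\prod_(k <- u) b k w)%:E) /\
  \int[P]_w (\prod_(k <- u) b k w) = \prod_(i < m) gauss_moment R (count_mem i u).
Proof.
have us : uniq (index_enum 'I_m ++ [::]) by rewrite cats0 index_enum_uniq.
have [|//||] := indep_prod_cat indb (f := fun i x => x ^+ count_mem i u) _ _ _ us.
- by move=> i; exact: measurable_funX.
- by move=> i _; have [] := gaussian_pow i (count_mem i u).
rewrite cats0 => i1 e1; split.
  by apply: eq_integrable i1 => // w _; rewrite [in RHS]prod_count.
under eq_Rintegral do rewrite prod_count.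
rewrite e1; apply: eq_bigr => i _; exact: (gaussian_pow i _).2.
Qed.

End gaussian_limit.

(** * Uniform moment bounds for the entries *)

Section bounded_moments.
Context d (T : measurableType d) (R : realType) (P : probability T R) (m : nat).
Variable X : 'I_m -> nat -> {RV P >-> R}.
Hypothesis hmom : forall i (k : nat), (3 <= k)%N ->
  exists C : R, forall j, ('E_P[fun w => (`|X i j w| ^+ k)%R] <= C%:E)%E.

Lemma integrable_norm_pow_ge3 i j k : (3 <= k)%N ->
  P.-integrable setT (fun w => (`|X i j w| ^+ k)%:E).
Proof.
move=> k3; have [C HC] := hmom i k3.
apply/integrableP; split.
  by apply/measurable_EFinP; apply: measurable_funX; exact: measurableT_comp.
apply: (@le_lt_trans _ _ C%:E); last exact: ltry.
have := HC j; rewrite unlock; congr (_ <= _)%E; apply: eq_integral => w _.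
by rewrite abse_EFin ger0_norm// exprn_ge0.
Qed.

(** The exponent [k + 3] is always in the range of [hmom], so all moments are controlled uniformly,
    those of order below 3 included. *)
Let pow_le_pow3 (y : R) k : 0 <= y -> y ^+ k <= 1 + y ^+ (k + 3).
Proof.
move=> y0; have [y1|/ltW y1] := leP y 1.
  by rewrite (@le_trans _ _ 1)// ?exprn_ile1// lerDl exprn_ge0.
by rewrite (@le_trans _ _ (y ^+ (k + 3)))// ?ler_weXn2l ?leq_addr// lerDr.
Qed.

Let integrable_1Dpow3 i j k : P.-integrable setT (fun w => (1 + `|X i j w| ^+ (k + 3))%:E).
Proof.
have i1 := finite_measure_integrable_cst P (1 : R) measurableT.
have := integrableD measurableT i1 (@integrable_norm_pow_ge3 i j (k + 3) (leq_addl _ _)).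
exact: eq_integrable.
Qed.

Lemma integrable_pow i j k : P.-integrable setT (fun w => (X i j w ^+ k)%:E).
Proof.
apply: le_integrable (integrable_1Dpow3 i j k) => //.
  by apply/measurable_EFinP; exact: measurable_funX.
move=> w _; rewrite !abse_EFin lee_fin normrX (le_trans (pow_le_pow3 _ _))//.
exact: ler_norm.
Qed.

(** Summing the bounds of the finitely many families makes [K] independent of the family. *)
Lemma moment_bound : exists K : nat -> R, forall (p : 'I_m * nat) k,
  `|moment (fun p => X p.1 p.2) p k| <= K k.
Proof.
have /choice [C HC] : forall ik : 'I_m * nat, exists C : R, forall j,
   ('E_P[fun w => (`|X ik.1 j w| ^+ (ik.2 + 3))%R] <= C%:E)%E.
  by move=> [i k]; exact: hmom (leq_addl _ _).
exists (fun k => \sum_(i < m) (1 + `|C (i, k)|)) => -[i j] k.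
rewrite (bigD1 i)//= ler_wpDr//.
  by apply: sumr_ge0 => *; rewrite addr_ge0.
have iX := integrable_pow i j k; have i3 := integrable_1Dpow3 i j k.
have inX := @integrable_norm_pow_ge3 i j (k + 3) (leq_addl _ _).
apply: (le_trans (le_normr_Rintegral measurableT iX)).
apply: (@le_trans _ _ (\int[P]_w (1 + `|X i j w| ^+ (k + 3)))).
  apply: le_Rintegral => //; first exact: integrable_abse iX.
  by move=> w _; rewrite normrX pow_le_pow3.
rewrite RintegralD//; last exact: (finite_measure_integrable_cst P (1 : R) measurableT).
rewrite Rintegral_prob_cst lerD2l (le_trans _ (ler_norm _))//.
have := HC (i, k) j; rewrite unlock /= -lee_fin /Rintegral fineK//.
exact: integrable_fin_num.
Qed.

End bounded_moments.

(** * Words in the circulant eigenvalues *)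

Section circulant_words.
Context d (T : measurableType d) (R : realType) (P : probability T R) (m : nat).
Variable X : 'I_m -> nat -> {RV P >-> R}.
Let Y (p : 'I_m * nat) : {RV P >-> R} := X p.1 p.2.
Hypothesis indY : indep_rvs P (fun p => Y p : T -> R).
Hypothesis intY : forall p k, P.-integrable setT (fun w => (Y p w ^+ k)%:E).

Let coef n (z : R[i]) (p : 'I_m * nat) : R := eigen_coef n z p.2 / Num.sqrt n.+1%:R.
Let idx n (i : 'I_m) := [seq (i, j) | j <- iota 0 n.+1].

(** Collecting equal letters gives a product of powers of linear combinations, one per family, over
    disjoint blocks of variables. *)
Lemma circ_word n z (u : seq 'I_m) :
  P.-integrable setT (fun w => (\prod_(k <- u)
     circ_eigen n (fun j => X k j w / Num.sqrt n.+1%:R) z)%:E) /\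
  \int[P]_w (\prod_(k <- u) circ_eigen n (fun j => X k j w / Num.sqrt n.+1%:R) z) =
  \prod_(i < m) sum_moment (coef n z) (moment Y) (idx n i) (count_mem i u).
Proof.
have us : uniq (flatten [seq idx n i | i <- index_enum 'I_m] ++ [::]).
  rewrite cats0; apply: (@allpairs_uniq _ _ _ pair) => //.
  - exact: index_enum_uniq.
  - exact: iota_uniq.
  - by move=> [i1 j1] [i2 j2] /=.
have d1 := decoupled_cst1 indY intY us.
have [d2 e2] := decoupled_prod_pow (coef n z) (fun i => count_mem i u) us d1.
have E w : 1 * \prod_(i <- index_enum 'I_m)
    (\sum_(p <- idx n i) coef n z p * Y p w) ^+ count_mem i u =
  \prod_(k <- u) circ_eigen n (fun j => X k j w / Num.sqrt n.+1%:R) z.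
  rewrite mul1r [in RHS]prod_count; apply: eq_bigr => i _; congr (_ ^+ _).
  rewrite /idx big_map -[iota 0 n.+1]/(index_iota 0 n.+1) big_mkord.
  by apply: eq_bigr => j _; rewrite /coef /Y /= mulrAC mulrA.
split.
  by have := decoupled_int d2; apply: eq_integrable => // w _ /=; rewrite E.
under eq_Rintegral do rewrite -E.
by rewrite e2 Rintegral_prob_cst mul1r.
Qed.

Hypothesis mean0 : forall p, moment Y p 1 = 0.
Hypothesis var1 : forall p, moment Y p 2 = 1.
Variable K : nat -> R.
Hypothesis momK : forall p k, `|moment Y p k| <= K k.

(** For self-inverse [t] the choice [eta = 1] gives mere boundedness, which is enough for at most
    two indices. Elsewhere [eta] is the bound on the normalized coefficients. *)
Lemma circ_word_close (u : seq 'I_m) : exists2 C : R, 0 <= C &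
  forall n (w : R[i]) (t : 'I_n.+1), n.+1.-primitive_root w -> (3 <= n)%N ->
  `|\int[P]_o (\prod_(k <- u) circ_eigen n (fun j => X k j o / Num.sqrt n.+1%:R) (w ^+ t))
    - \prod_(i < m) gauss_moment R (count_mem i u)|
  <= C * (if t == - t then 1 else 2 / Num.sqrt n.+1%:R).
Proof.
have /choice [D HD] : forall i : 'I_m, exists D : R, 0 <= D /\ forall (a : 'I_m * nat -> R)
    (eta : R) (s : seq ('I_m * nat)),
    eta <= 1 -> (forall p, `|a p| <= eta) -> `|\sum_(j <- s) a j ^+ 2 - 1| <= eta ->
    `|sum_moment a (moment Y) s (count_mem i u) - gauss_moment R (count_mem i u)| <= D * eta.
  move=> i; have [D D0 HD] := sum_moment_close K (count_mem i u).
  exists D; split => // a eta s e1 ae ve; apply: HD => //.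
  by move=> p; exact: moment0.
have [C C0 HC] := @prod_close R 'I_m (index_enum 'I_m) (fun i => gauss_moment R (count_mem i u)) D
  (fun i => (HD i).1).
exists C => // n w t wP n3; rewrite (circ_word _ _ _).2.
(* With at least four rows, [2 / Num.sqrt n.+1%:R] is at most 1. *)
have sq2 : 2 <= Num.sqrt n.+1%:R :> R.
  have -> : 2 = Num.sqrt (2 ^+ 2) :> R by rewrite sqrtr_sqr ger0_norm.
  by rewrite ler_sqrt// -natrX ler_nat.
have sq0 : 0 < Num.sqrt n.+1%:R :> R by rewrite (lt_le_trans _ sq2).
have sqE : Num.sqrt n.+1%:R ^+ 2 = n.+1%:R :> R by rewrite sqr_sqrtr.
have dl1 : 2 / Num.sqrt n.+1%:R <= 1 :> R by rewrite ler_pdivrMr// mul1r.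
set eta := (if _ then _ else _).
have eta1 : eta <= 1 by rewrite /eta; case: ifP.
have dle : 2 / Num.sqrt n.+1%:R <= eta by rewrite /eta; case: ifP.
have zN : (w ^+ t) ^+ n.+1 = 1 by rewrite exprAC (prim_expr_order wP) expr1n.
apply: HC => //; first by rewrite (le_trans _ dle)// divr_ge0// ltW.
move=> i; apply: (HD i).2 => //.
  move=> p; apply: le_trans dle; rewrite /coef normrM normfV (gtr0_norm sq0).
  by rewrite ler_pM2r ?invr_gt0// eigen_coef_le2.
rewrite /idx big_map -[iota 0 n.+1]/(index_iota 0 n.+1) big_mkord.
under eq_bigr do rewrite /coef /= exprMn exprVn sqE.
rewrite -mulr_suml sum_eigen_coef2// (root_sqr_eq1 wP).
(* With [f] the number of self-inverse residues and [N = n.+1], the variance minus 1 is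
   [(N - f) / N], between 0 and 1, when [t] is self-inverse, and [- f / N] otherwise, where
   [f <= 2]. *)
have f2 := card_selfinv n; have fN := max_card [pred l : 'I_n.+1 | l == - l].
rewrite card_ord in fN; move: f2 fN; set f := #|_| => f2 fN.
have N0 : 0 < n.+1%:R :> R by [].
have fieldE (c x y : R) : x != 0 -> (c * x + x - y) / x - 1 = (c * x - y) / x.
  by move=> x0; field.
rewrite (_ : (if t == - t then n.+1%:R else 0) = (t == - t)%:R * n.+1%:R); last first.
  by case: ifP; rewrite ?mul1r ?mul0r.
rewrite fieldE; last by rewrite gt_eqF.
rewrite /eta; case: ifP => _.
  rewrite mul1r.
  rewrite ger0_norm ?divr_ge0 ?subr_ge0 ?ler_nat// ler_pdivrMr// mul1r.
  by rewrite lerBlDr lerDl.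
rewrite mul0r sub0r mulNr normrN ger0_norm ?divr_ge0// ler_pM ?invr_ge0 ?ler_nat//.
by rewrite lef_pV2// -[leRHS]sqE expr2 ler_peMr// ?(ltW sq0)// (le_trans _ sq2)// ler1n.
Qed.

Lemma circ_word_cvg (w : nat -> R[i]) (u : seq 'I_m) :
  (forall n, n.+1.-primitive_root (w n)) ->
  n.+1%:R^-1 * (\sum_(t < n.+1) \int[P]_o (\prod_(k <- u)
     circ_eigen n (fun j => X k j o / Num.sqrt n.+1%:R) (w n ^+ t))) @[n --> \oo] -->
  \prod_(i < m) gauss_moment R (count_mem i u).
Proof.
move=> wP; have [C C0 HC] := circ_word_close u.
(* With [N = n.+1], the average of the bounds of [circ_word_close] is at most
   [C * (2 / N + 2 / sqrt N)], hence at most [4 * C / sqrt N], which is [h n]. *)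
set G := \prod_(i < m) _; pose h (n : nat) : R := 4 * C * Num.sqrt (harmonic n).
have h0 : h n @[n --> \oo] --> (0 : R).
  rewrite /h -[X in _ --> X](mulr0 (4 * C)); apply: cvgMr.
  have := @sqrt_continuous R 0; rewrite /continuous_at sqrtr0.
  by move/(cvg_comp _ _ (@cvg_harmonic R)); apply.
apply: (@squeeze_cvgr _ _ _ _ (fun n => G - h n) (fun n => G + h n)).
- near=> n; rewrite -ler_distlC.
  have n3 : (3 <= n)%N by near: n; exact: nbhs_infty_ge.
  pose E (t : 'I_n.+1) := \int[P]_o (\prod_(k <- u)
     circ_eigen n (fun j => X k j o / Num.sqrt n.+1%:R) (w n ^+ t)).
  rewrite distrC -[X in _ * X](_ : \sum_(t < n.+1) E t = _)//.
  have N0 : 0 < n.+1%:R :> R by [].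
  have -> : n.+1%:R^-1 * (\sum_(t < n.+1) E t) - G = n.+1%:R^-1 * \sum_(t < n.+1) (E t - G).
    by rewrite sumrB sumr_const card_ord mulrBr -[G *+ _]mulr_natl mulrA mulVf ?mul1r.
  rewrite normrM normfV (gtr0_norm N0) mulrC ler_pdivrMr//.
  apply: le_trans (ler_norm_sum _ _ _) _.
  apply: (@le_trans _ _ (\sum_(t < n.+1) C * ((t == - t)%:R + 2 / Num.sqrt n.+1%:R))).
    apply: ler_sum => t _; apply: le_trans (HC n (w n) t (wP n) n3) _.
    rewrite ler_wpM2l//; case: ifP => _; last by rewrite add0r.
    by rewrite lerDl divr_ge0// sqrtr_ge0.
  rewrite -mulr_sumr big_split /= sumr_const card_ord -natr_sum.
  have -> : (\sum_(t < n.+1) (t == - t) = #|[pred l : 'I_n.+1 | l == - l]|)%N.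
    rewrite -sum1_card [RHS]big_mkcond; apply: eq_bigr => l _.
    by rewrite inE; case: (l == - l).
  rewrite /h /harmonic/= sqrtrV//.
  set f := #|_|; have : (f <= 2)%N by exact: card_selfinv.
  rewrite -(ler_nat R); move: (f%:R) => {}f f2.
  have sqE : n.+1%:R = Num.sqrt n.+1%:R ^+ 2 :> R by rewrite sqr_sqrtr.
  have s1 : 1 <= Num.sqrt n.+1%:R :> R by rewrite -[leLHS]sqrtr1 ler_sqrt// ler1n.
  rewrite -[_ *+ n.+1]mulr_natr; move: (Num.sqrt n.+1%:R) s1 sqE => s s1 ->.
  have s0 : s != 0 by rewrite gt_eqF// (lt_le_trans _ s1).
  rewrite (_ : 2 / s * s ^+ 2 = 2 * s); last by field.
  rewrite (_ : 4 * C / s * s ^+ 2 = C * (4 * s)); last by field.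
  by rewrite ler_wpM2l//; lra.
- by rewrite -[X in _ --> X]subr0; apply: cvgB => //; exact: cvg_cst.
- by rewrite -[X in _ --> X]addr0; apply: cvgD => //; exact: cvg_cst.
Unshelve. all: end_near. Qed.

End circulant_words.

Theorem theorem4
  (R : realType) (d : measure_display) (T : measurableType d)
  (P : probability T R) (m : nat) (hm : (0 < m)%N)
  (X : 'I_m -> nat -> {RV P >-> R})
  (hfam : indep_family P (fun i => sigma_rvs (fun j => X i j : T -> R)))
  (hind : forall i, indep_rvs P (fun j => X i j : T -> R))
  (hmean : forall i j, ('E_P[X i j] = 0)%E)
  (hvar : forall i j, ('E_P[fun w => (X i j w ^+ 2)%R] = 1)%E)
  (hmom : forall i (k : nat), (3 <= k)%N ->
     exists C : R, forall j, ('E_P[fun w => (`|X i j w| ^+ k)%R] <= C%:E)%E)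
  (d' : measure_display) (T' : measurableType d') (P' : probability T' R)
  (b : 'I_m -> {RV P' >-> R})
  (hbind : indep_rvs P' (fun i => b i : T' -> R))
  (hbgauss : forall i (A : set R), measurable A ->
     distribution P' (b i) A = normal_prob 0 1 A)
  (Q : ncpoly R m) :
  let phiQ := fun n : nat =>
    phi_n P (fun w => eval_ncpoly Q
      (fun i => map_mx (fun x => (x%:C)%C) (sym_circulant (fun j => X i j : T -> R) n w))) in
  let lim := cexpectation P' (fun w => eval_ncpoly_comm Q (fun i => b i w)) in
  (fun n => complex.Re (phiQ n)) @ \oo --> complex.Re lim /\
  (fun n => complex.Im (phiQ n)) @ \oo --> complex.Im lim.
Proof.
move=> phiQ lim.
have indY := indep_family_rvs hfam hind.
have intY := integrable_pow hmom.
have [K momK] := moment_bound hmom.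
have /choice [w wP] : forall n, exists w : R[i], n.+1.-primitive_root w by exact: prim_root_exists.
have mean0 (p : 'I_m * nat) : moment (fun p => X p.1 p.2) p 1 = 0.
  have := hmean p.1 p.2; rewrite unlock /moment /Rintegral => e.
  by under eq_integral do rewrite expr1; rewrite e.
have var1 (p : 'I_m * nat) : moment (fun p => X p.1 p.2) p 2 = 1.
  by have := hvar p.1 p.2; rewrite unlock /moment /Rintegral => ->.
(* For the word of a monomial [q], [V n q] is the trace at size [n.+1], [A n q] its normalized
   expectation and [G q] the Gaussian limit. *)
pose V n (q : R[i] * seq 'I_m) o := \sum_(t < n.+1) \prod_(k <- q.2)
  circ_eigen n (fun j => X k j o / Num.sqrt n.+1%:R) (w n ^+ t).
pose A n (q : R[i] * seq 'I_m) := n.+1%:R^-1 * \sum_(t < n.+1) \int[P]_o (\prod_(k <- q.2)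
  circ_eigen n (fun j => X k j o / Num.sqrt n.+1%:R) (w n ^+ t)).
pose G (q : R[i] * seq 'I_m) := \prod_(i < m) gauss_moment R (count_mem i q.2).
have VA n q : P.-integrable setT (EFin \o V n q) /\ n.+1%:R^-1 * \int[P]_o V n q o = A n q.
  pose W (t : 'I_n.+1) o := \prod_(k <- q.2)
    circ_eigen n (fun j => X k j o / Num.sqrt n.+1%:R) (w n ^+ t).
  have iW (t : 'I_n.+1) : P.-integrable setT (EFin \o W t).
    exact: (circ_word indY (fun p k => intY p.1 p.2 k) n (w n ^+ t) q.2).1.
  have VW : V n q = fun o => \sum_(t < n.+1) 1 * W t o.
    by apply/funext => o; apply: eq_bigr => t _; rewrite mul1r.
  have [i1 e1] := Rintegral_lincomb (index_enum 'I_n.+1) (fun=> 1) iW.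
  rewrite VW e1; split; first exact: i1.
  by congr (_ * _); apply: eq_bigr => t _; rewrite mul1r.
have phiE n : phiQ n.+1 = \sum_(q <- Q) q.1 * ((A n q)%:C)%C.
  rewrite /phiQ /phi_n.
  rewrite (_ : (fun o => _) = (fun o => \sum_(q <- Q) q.1 * ((V n q o)%:C)%C)); last first.
    apply/funext => o; rewrite /eval_ncpoly raddf_sum; apply: eq_bigr => q _.
    rewrite [LHS]mxtraceZ; congr (_ * _).
    rewrite rmorph_sum -(trace_circ_word (wP n)); congr (\tr (eval_word _ _)).
    by apply/funext => i; apply/matrixP => r s; rewrite !mxE.
  rewrite cexpectation_lin; last by move=> q; exact: (VA n q).1.
  rewrite mulr_sumr; apply: eq_bigr => q _; rewrite mulrCA; congr (_ * _).
  by rewrite -(VA n q).2 rmorphM fmorphV rmorph_nat.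
have limE : lim = \sum_(q <- Q) q.1 * ((G q)%:C)%C.
  rewrite /lim /eval_ncpoly_comm cexpectation_lin; last first.
    by move=> q; exact: (gaussian_word hbind hbgauss q.2).1.
  by apply: eq_bigr => q _; rewrite (gaussian_word hbind hbgauss q.2).2.
have AG q : A n q @[n --> \oo] --> G q.
  have H := circ_word_cvg indY (fun p k => intY p.1 p.2 k) mean0 var1 momK.
  exact: (H w q.2 wP).
have cvg_lin (h : R[i] -> R) : (forall x y, h (x + y) = h x + h y) ->
    (forall x v, h (x * (v%:C)%C) = h x * v) -> h 0 = 0 ->
    h (phiQ n) @[n --> \oo] --> h lim.
  move=> hD hM h0.
  have hS (v : R[i] * seq 'I_m -> R) :
      h (\sum_(q <- Q) q.1 * ((v q)%:C)%C) = \sum_(q <- Q) h q.1 * v q.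
    by elim: (Q) => [|q r IH]; rewrite ?big_nil// !big_cons hD hM IH.
  have sum_cvg r : (\sum_(q <- r) h q.1 * A n q) @[n --> \oo] --> \sum_(q <- r) h q.1 * G q.
    elim: r => [|q r IH].
      rewrite big_nil (_ : (fun n => _) = fun=> 0); first exact: cvg_cst.
      by apply/funext => n; rewrite big_nil.
    rewrite big_cons (_ : (fun n => _) = fun n => h q.1 * A n q + \sum_(q <- r) h q.1 * A n q).
      by apply: cvgD => //; apply: cvgMr; exact: AG.
    by apply/funext => n; rewrite big_cons.
  (* Shifting the sequence discards size 0, where there is no spectrum to use. *)
  rewrite -(cvg_shiftS (fun n => h (phiQ n))) limE hS.
  rewrite (_ : [sequence _]_n = fun n => \sum_(q <- Q) h q.1 * A n q); first exact: sum_cvg.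
  by apply/funext => n; rewrite /= phiE hS.
split; apply: cvg_lin => //.
- by case=> x1 y1 [x2 y2].
- by case=> x y v /=; rewrite mulr0 subr0.
- by case=> x1 y1 [x2 y2].
- by case=> x y v /=; rewrite mulr0 add0r.
Qed.
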